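(* Let $(R,\mathfrak m)$ be a Cohen-Macaulay local ring of dimension two with infinite residue field, let $s\geq2$ and let $I_1,\ldots,I_s$ be $\mathfrak m$-primary ideals of $R$. Let $\mathcal F=\{\mathcal F(\underline n)\}_{\underline n\in\mathbb Z^s}$ be an $\underline I$-admissible filtration of ideals in $R$ and let $\mathcal A=\{x_{ij}\in I_i: j=1,2;\ i=1,\ldots,s\}$ be a good complete reduction of $\mathcal F$. Suppose $H^1_{\mathcal R_{++}}(\mathcal R(\mathcal F))_{\underline n}=0$ for all $\underline n\geq\underline 0$. Then $\mathcal P(\mathcal F)\subseteq\mathbb N^s$ and there is a one-to-one correspondence $$f:\mathcal P(\mathcal F)\longleftrightarrow\{\underline r\in\mathcal R_{\mathcal A}(\mathcal F)\mid \underline r\geq e\}$$ defined by $f(\underline n)=\underline n+e$, with inverse $f^{-1}(\underline r)=\underline r-e$.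
   Context: Notation: $\mathbb N=\{0,1,2,\ldots\}$, $\lambda$ denotes length over $R$, $e=(1,\ldots,1)\in\mathbb Z^s$, $\underline 0=(0,\dots,0)$; $\underline n\ge\underline m$ means componentwise inequality; $\underline n^+=(\max(n_1,0),\ldots,\max(n_s,0))$; $\underline I=(I_1,\ldots,I_s)$ and $\underline I^{\underline n}=I_1^{n_1}\cdots I_s^{n_s}$, where a nonpositive power of an ideal is $R$. ''For all large $\underline n$'' means for all $\underline n\in\mathbb N^s$ with every $n_i\gg0$. Filtrations: a $\mathbb Z^s$-graded $\underline I$-filtration is a family of ideals $\mathcal F=\{\mathcal F(\underline n)\}_{\underline n\in\mathbb Z^s}$ of $R$ with $\underline I^{\underline n}\subseteq\mathcal F(\underline n)$, $\mathcal F(\underline n)\mathcal F(\underline m)\subseteq\mathcal F(\underline n+\underline m)$, and $\mathcal F(\underline m)\subseteq\mathcal F(\underline n)$ whenever $\underline m\geq\underline n$. It is $\underline I$-admissible if moreover $\mathcal F(\underline n)=\mathcal F(\underline n^+)$ for all $\underline n$ and $\bigoplus_{\underline n\in\mathbb Z^s}\mathcal F(\underline n)\underline t^{\underline n}$ is a finite module over $\bigoplus_{\underline n\in\mathbb Z^s}\underline I^{\underline n}\underline t^{\underline n}$, where $t_1,\dots,t_s$ are indeterminates and $\underline t^{\underline n}=t_1^{n_1}\cdots t_s^{n_s}$. Rees rings: $\mathcal R(\mathcal F)=\bigoplus_{\underline n\in\mathbb N^s}\mathcal F(\underline n)\underline t^{\underline n}$, $\mathcal R(\underline I)=\bigoplus_{\underline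 n\in\mathbb N^s}\underline I^{\underline n}\underline t^{\underline n}$, and $\mathcal R_{++}=\bigoplus_{\underline n\ge e}\underline I^{\underline n}\underline t^{\underline n}$, an ideal of $\mathcal R(\underline I)$. $H^1_{\mathcal R_{++}}(\mathcal R(\mathcal F))$ is the first local cohomology of the $\mathcal R(\underline I)$-module $\mathcal R(\mathcal F)$ with support in $\mathcal R_{++}$; the subscript $\underline n$ denotes the degree $\underline n$ component. $H_{\mathcal F}(\underline n)=\lambda(R/\mathcal F(\underline n))$, and $P_{\mathcal F}$ is the unique polynomial with $P_{\mathcal F}(\underline n)=H_{\mathcal F}(\underline n)$ for all large $\underline n$. A vector $\underline n\in\mathbb Z^s$ is a postulation vector of $\mathcal F$ if $H_{\mathcal F}(\underline m)=P_{\mathcal F}(\underline m)$ for all $\underline m\ge\underline n$ (in $\mathbb Z^s$); $\mathcal P(\mathcal F)\subseteq\mathbb Z^s$ is the set of postulation vectors. With $\dim R=2$, a set $\mathcal A=\{x_{ij}\in I_i:j=1,2;\ i=1,\dots,s\}$ is a complete reduction of $\mathcal F$ if, with $y_j=x_{1j}\cdots x_{sj}$ and $J=(y_1,y_2)$, $J\mathcal F(\underline n)=\mathcal F(\underline n+e)$ for all large $\underline n\in\mathbb N^s$. It is a good complete reduction if in addition $\mathcal F(\underline m)\cap(y_1)=y_1\mathcal F(\underline m-e)$ for all large $\underline m\in\mathbb N^s$. A vector $\underline r\in\mathbb N^s$ is a reduction vector of $\mathcal F$ with respect to $\mathcal A$ if $J\mathcal F(\underline n)=\mathcal F(\underline n+e)$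 for all $\underline n\ge\underline r$; $\mathcal R_{\mathcal A}(\mathcal F)$ is the set of all reduction vectors of $\mathcal F$ with respect to $\mathcal A$. *)

(* Defs.v *)
From HB Require Import structures.
From mathcomp Require Import all_boot all_order all_algebra.
From mathcomp Require Import finmap.
From mathcomp Require Import boolp classical_sets functions.
From mathcomp Require Import monalg.
From mathcomp Require mpoly.

Set Implicit Arguments.
Unset Strict Implicit.
Unset Printing Implicit Defensive.

Import Order.TTheory GRing.Theory Num.Theory.
Local Open Scope classical_set_scope.
Local Open Scope ring_scope.

Definition is_max_nat (Q : nat -> Prop) (k : nat) : Prop :=
  Q k /\ forall k', Q k' -> (k' <= k)%N.

(* strictly increasing chains of length k, i.e. with k + 1 members *)
Definition is_chain (T : Type) (P : set T -> Prop) (k : nat) : Prop :=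
  exists C : nat -> set T,
    (forall i, (i <= k)%N -> P (C i)) /\
    (forall i, (i < k)%N -> C i `<` C i.+1).

Section Ideals.
Variable R : comNzRingType.
Implicit Types (I J m : set R).

Definition is_ideal I : Prop :=
  [/\ I 0, (forall a b, I a -> I b -> I (a + b))
    & (forall a b, I b -> I (a * b))].

Definition ideal_of (g : seq R) : set R :=
  [set x | exists c : 'I_(size g) -> R, x = \sum_(i < size g) c i * g`_i].

Definition ideal_mul I J : set R :=
  [set x | exists2 u : seq (R * R),
     (forall p, p \in u -> I p.1 /\ J p.2) & x = \sum_(p <- u) p.1 * p.2].

Definition ideal_pow I (k : nat) : set R := iter k (ideal_mul I) setT.

Definition is_prime I : Prop :=
  [/\ is_ideal I, ~ I 1 & forall a b, I (a * b) -> I a \/ I b].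

Definition is_maximal I : Prop :=
  [/\ is_ideal I, ~ I 1
    & forall J, is_ideal J -> ~ J 1 -> I `<=` J -> J = I].

Definition is_primary I : Prop :=
  [/\ is_ideal I, ~ I 1
    & forall a b, I (a * b) -> I a \/ exists k, I (b ^+ k)].

Definition radical I : set R := [set a | exists k, I (a ^+ k)].

Definition is_mprimary m I : Prop := is_primary I /\ radical I = m.

Definition noetherian : Prop :=
  forall I, is_ideal I -> exists g : seq R, I = ideal_of g.

Definition is_local m : Prop :=
  is_maximal m /\ forall m', is_maximal m' -> m' = m.

(* R/m is infinite: no finite list represents all the classes modulo m *)
Definition infinite_residue_field m : Prop :=
  forall u : seq R, exists a, forall b, b \in u -> ~ m (a - b).

Definition krull_dim (d : nat) : Prop := is_max_nat (is_chain is_prime) d.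

Definition regular_seq (g : seq R) : Prop :=
  (forall i, (i < size g)%N ->
     forall a, ideal_of (take i g) (g`_i * a) -> ideal_of (take i g) a) /\
  ~ ideal_of g 1.

Definition depth m (d : nat) : Prop :=
  is_max_nat (fun k => exists g : seq R,
    [/\ size g = k, (forall a, a \in g -> m a) & regular_seq g]) d.

Definition cohen_macaulay_local m : Prop :=
  [/\ noetherian, is_local m & exists d, krull_dim d /\ depth m d].

(* Submodules of R/I are the ideals containing I; the length of R/I is the
   maximal length of a chain of those. *)
Definition is_colength I (k : nat) : Prop :=
  is_max_nat (is_chain (fun J => is_ideal J /\ I `<=` J)) k.

(* The default value 0 is only taken when R/I has infinite length. *)
Definition colength I : nat := xget 0%N (is_colength I).

End Ideals.

Section Vectors.
Variable s : nat.

Definition vec : Type := {ffun 'I_s -> int}.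
HB.instance Definition _ := GRing.Zmodule.on vec.
Implicit Types (n p : vec).

Definition vle n p : Prop := forall i, n i <= p i.
Definition vone : vec := [ffun=> 1].
Definition vpos n : vec := [ffun i => Num.max (n i) 0].

Definition for_all_large (Q : vec -> Prop) : Prop :=
  exists N : nat, forall n, (forall i, N%:Z <= n i) -> Q n.

End Vectors.
Arguments vone {s}.

(* The Laurent polynomial ring R[t_1^{+-1}, ..., t_s^{+-1}]: finitely supported
   families of coefficients with the convolution product.  The ring structure
   of {malg R[K]} in the library requires that 1 be the only invertible
   monomial, hence the construction below. *)
Section Laurent.
Variables (R : comNzRingType) (s : nat).

Definition laurent : Type := {malg R[vec s]}.
HB.instance Definition _ := GRing.Zmodule.on laurent.
Implicit Types (f g h : laurent).

Definition monom (c : R) (n : vec s) : laurent := << c *g n >>.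
Definition lone : laurent := monom 1 0.
Definition lmul f g : laurent :=
  \sum_(n <- msupp f) \sum_(p <- msupp g) monom (f@_n * g@_p) (n + p).

Let monom0 n : monom 0 n = 0. Proof. exact: monalgU0. Qed.

Let monomD c d n : monom (c + d) n = monom c n + monom d n.
Proof. exact: monalgUD. Qed.

Let lmulw (d1 d2 : {fset vec s}) f g :
  (msupp f `<=` d1)%fset -> (msupp g `<=` d2)%fset ->
  lmul f g = \sum_(n <- d1) \sum_(p <- d2) monom (f@_n * g@_p) (n + p).
Proof.
move=> le1 le2; rewrite /lmul (big_fset_incl _ le1) /=.
  apply: eq_bigr => n _; apply: big_fset_incl => // p _ /mcoeff_outdom ->.
  by rewrite mulr0 monom0.
move=> n _ /mcoeff_outdom fn.
by rewrite big1 // => p _; rewrite fn mul0r monom0.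
Qed.

Let lmulC : commutative lmul.
Proof.
move=> f g; rewrite /lmul exchange_big; apply: eq_bigr => n _.
by apply: eq_bigr => p _; rewrite mulrC addrC.
Qed.

Let lmulDl : left_distributive lmul +%R.
Proof.
move=> f g h.
rewrite (lmulw (msuppD_le f g) (fsubset_refl _)).
rewrite (lmulw (fsubsetUl (msupp f) (msupp g)) (fsubset_refl _)).
rewrite (lmulw (fsubsetUr (msupp f) (msupp g)) (fsubset_refl _)).
rewrite -big_split /=; apply: eq_bigr => n _.
rewrite -big_split /=; apply: eq_bigr => p _.
by rewrite mcoeffD mulrDl monomD.
Qed.

Let lmulDr : right_distributive lmul +%R.
Proof. by move=> f g h; rewrite !(lmulC f) lmulDl. Qed.

Let lmul0g : left_zero 0 lmul.
Proof. by move=> g; rewrite /lmul msupp0 big_seq_fset0. Qed.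

Let lmulg0 : right_zero 0 lmul.
Proof. by move=> g; rewrite lmulC lmul0g. Qed.

Let lmulUU c d n p : lmul (monom c n) (monom d p) = monom (c * d) (n + p).
Proof.
by rewrite (lmulw msuppU_le msuppU_le) !big_seq_fset1 !mcoeffUU.
Qed.

Let lmulEl f g : lmul f g = \sum_(n <- msupp f) lmul (monom f@_n n) g.
Proof.
rewrite {1}[f]monalgE.
by rewrite (big_morph (lmul^~ g) (fun a b => lmulDl a b g) (lmul0g g)).
Qed.

Let lmulEr f g : lmul f g = \sum_(n <- msupp g) lmul f (monom g@_n n).
Proof. by rewrite lmulC lmulEl; apply: eq_bigr => n _; rewrite lmulC. Qed.

Let lmul1g : left_id lone lmul.
Proof.
move=> g; rewrite lmulEr [RHS]monalgE; apply: eq_bigr => n _.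
by rewrite lmulUU mul1r add0r.
Qed.

Let lmulA : associative lmul.
Proof.
move=> f g h.
rewrite [lmul f g]lmulEl.
rewrite (big_morph (lmul^~ h) (fun a b => lmulDl a b h) (lmul0g h)).
rewrite lmulEl; apply: eq_bigr => n _.
rewrite [lmul g h]lmulEl [lmul (monom _ _) g]lmulEr.
rewrite (big_morph (lmul^~ h) (fun a b => lmulDl a b h) (lmul0g h)).
rewrite (big_morph (lmul _) (fun a b => lmulDr _ a b) (lmulg0 _)).
apply: eq_bigr => p _.
rewrite lmulUU [RHS]lmulEr [lmul _ h]lmulEr.
rewrite (big_morph (lmul _) (fun a b => lmulDr _ a b) (lmulg0 _)).
by apply: eq_bigr => q _; rewrite !lmulUU mulrA addrA.
Qed.

Let lone_neq0 : lone != 0.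
Proof. by rewrite monalgU_eq0 oner_eq0. Qed.

HB.instance Definition _ := GRing.Zmodule_isComNzRing.Build laurent
  lmulA lmulC lmul1g lmulDl lone_neq0.

Definition lcoef (f : laurent) (n : vec s) : R := f@_n.

Definition homogeneous (n : vec s) : set laurent :=
  [set f | forall p, p != n -> lcoef f p = 0].

(* \bigoplus_n G(n) t^n *)
Definition graded_sum (G : vec s -> set R) : set laurent :=
  [set f | forall n, G n (lcoef f n)].

(* \bigoplus_(n >= n0) G(n) t^n *)
Definition graded_sum_from (n0 : vec s) (G : vec s -> set R) : set laurent :=
  [set f | graded_sum G f /\ forall n, lcoef f n != 0 -> vle n0 n].

End Laurent.

(* For a subring A of L and an additive subgroup M of L stable under A *)
Section Submodules.
Variable L : comNzRingType.
Implicit Types (A M : set L).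

Definition generated_by A M (k : nat) (x : 'I_k -> L) : Prop :=
  (forall i, M (x i)) /\
  forall f, M f -> exists2 a : 'I_k -> L,
    (forall i, A (a i)) & f = \sum_(i < k) a i * x i.

Definition finite_module A M : Prop :=
  exists k (x : 'I_k -> L), generated_by A M x.

(* A pair (f, j) stands for the fraction f / x^j of the localisation M_x. *)
Definition frac_eq (x : L) (u v : L * nat) : Prop :=
  exists l : nat, x ^+ l * (x ^+ v.2 * u.1 - x ^+ u.2 * v.1) = 0.

End Submodules.

(* Cech complex of a graded submodule M of L = laurent R s with respect to
   homogeneous elements x_i of degree d_i:
     M -> \bigoplus_i M_(x_i) -> \bigoplus_(i < j) M_(x_i x_j).
   The fraction f / x_i^j has degree n when f has degree n + j d_i. *)
Section Cech.
Variables (R : comNzRingType) (s : nat).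
Let L : comNzRingType := laurent R s.
Variables (M : set L) (k : nat) (x : 'I_k -> L) (d : 'I_k -> vec s).

Definition cech_cochain1 (n : vec s) (u : 'I_k -> L * nat) : Prop :=
  forall i, M (u i).1 /\ homogeneous (n + d i *+ (u i).2) (u i).1.

Definition cech_cocycle1 (u : 'I_k -> L * nat) : Prop :=
  forall i j : 'I_k, (i < j)%N ->
    frac_eq (x i * x j) (x j ^+ (u i).2 * (u i).1, (u i).2)
                        (x i ^+ (u j).2 * (u j).1, (u j).2).

Definition cech_coboundary1 (n : vec s) (u : 'I_k -> L * nat) : Prop :=
  exists f : L, [/\ M f, homogeneous n f & forall i, frac_eq (x i) (f, 0%N) (u i)].

Definition cech_H1_zero (n : vec s) : Prop :=
  forall u, cech_cochain1 n u -> cech_cocycle1 u -> cech_coboundary1 n u.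

End Cech.

(* H^1_a(M)_n = 0, for a homogeneous finitely generated ideal a of A and a
   graded A-module M: local cohomology is the cohomology of the Cech complex
   on a finite system of homogeneous generators of a, and does not depend on
   the system. *)
Definition local_cohomology1_zero (R : comNzRingType) (s : nat)
    (A a M : set (laurent R s)) (n : vec s) : Prop :=
  exists k (x : 'I_k -> laurent R s) (d : 'I_k -> vec s),
    [/\ generated_by A a x, (forall i, homogeneous (d i) (x i))
      & cech_H1_zero M x d n].

Section Filtrations.
Variables (R : comNzRingType) (s : nat).
Implicit Types (I : 'I_s -> set R) (F : vec s -> set R) (n m r : vec s).

(* |max(n_i, 0)| is the truncation of n_i to nat: nonpositive powers are R *)
Definition mpow I n : set R :=
  \big[@ideal_mul R/setT]_(i < s) ideal_pow (I i) `|Num.max (n i) 0|%N.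

Definition is_filtration I F : Prop :=
  [/\ forall n, is_ideal (F n),
      forall n, mpow I n `<=` F n,
      forall n m, ideal_mul (F n) (F m) `<=` F (n + m)
    & forall n m, vle n m -> F m `<=` F n].

Definition is_admissible I F : Prop :=
  [/\ is_filtration I F, forall n, F n = F (vpos n)
    & finite_module (graded_sum (mpow I)) (graded_sum F)].

Definition Rees F : set (laurent R s) := graded_sum_from 0 F.
Definition Rees_pp I : set (laurent R s) := graded_sum_from vone (mpow I).

Definition hilbert_fun F n : nat := colength (F n).

Definition peval (P : mpoly.mpoly s rat) n : rat :=
  mpoly.meval (fun i => (n i)%:~R) P.

Definition is_hilbert_poly F (P : mpoly.mpoly s rat) : Prop :=
  for_all_large (fun n => peval P n = (hilbert_fun F n)%:R).

(* P is meant to be the Hilbert polynomial of F *)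
Definition postulation_vectors F (P : mpoly.mpoly s rat) : set (vec s) :=
  [set n | forall m, vle n m -> (hilbert_fun F m)%:R = peval P m].

Variable x : 'I_s -> 'I_2 -> R.

Definition yprod (j : 'I_2) : R := \prod_(i < s) x i j.
Definition Jideal : set R := ideal_of [:: yprod ord0; yprod ord_max].

Definition is_complete_reduction I F : Prop :=
  (forall i j, I i (x i j)) /\
  for_all_large (fun n => ideal_mul Jideal (F n) = F (n + vone)).

Definition is_good_complete_reduction I F : Prop :=
  is_complete_reduction I F /\
  for_all_large (fun m => F m `&` ideal_of [:: yprod ord0] =
                          ( *%R (yprod ord0)) @` F (m - vone)).

Definition reduction_vectors F : set (vec s) :=
  [set r | vle 0 r /\
     forall n, vle r n -> ideal_mul Jideal (F n) = F (n + vone)].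

End Filtrations.

(* Main.v *)
Require Import Defs.
From mathcomp Require Import all_boot all_order all_algebra.
From mathcomp Require Import finmap boolp classical_sets functions monalg.
From mathcomp Require mpoly.
From mathcomp Require Import ring lra zify.

(** Write e = (1, ..., 1), H(n) for the colength of F(n), c for the colength of
    J = (y1, y2), and D = P - H.

    In a Cohen-Macaulay ring of dimension two y1, y2 is a regular sequence
    (y_regular): its Koszul homology is killed by J, which contains a regular
    sequence of length two.  Hence the syzygies of y1, y2 are trivial, and
    counting lengths in J/JF(n) gives
      colength (J F(n)) + colength (F(n) : J) = c + 2 H(n)
    (colength_mul2).  So wherever F(n) : J = F(n - e), the equality
    J F(n) = F(n + e) says exactly that H(n + e) - 2 H(n) + H(n - e) = c
    (reduction_diff).  For large n both equalities hold, because the complete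
    reduction is good; hence P satisfies this second difference equation for
    every n (peval_second_diff), P being a polynomial on each line in the
    direction e.

    The vanishing of the local cohomology in degree n >= 0 gives
    F(n + e) : J = F(n) (colon_of_H1_zero), since an element a of the colon ideal
    defines a section a t^n outside the irrelevant locus, and such a section
    must extend.  Therefore, for n >= e, J F(n) = F(n + e) if and only if
    D(n + e) - 2 D(n) + D(n - e) = 0.  If D vanishes from n on, then n + e is a
    reduction vector; conversely, from a reduction vector n + e on, D is an
    arithmetic progression along e that ends in zeros, so it vanishes from n on
    (postulation_reduction).

    It remains to see that postulation vectors are nonnegative
    (postulation_ge0).  Suppose that n is one and that n_i < 0.  Put e' = e - u
    with u the i-th unit vector, and let T be the mixed difference of P in the
    directions u and e'.  Since F(q) depends only on the positive part of q,
    H(q + u) = H(q) whenever q_i = -1, so T vanishes at a point m0 with i-th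
    coordinate -1 and the others large.  By the second difference equation T is
    affine along the line m0 + k e.  On the other hand, with y1 = x_i w, for
    large q the number T(q) is the length of F(q) / (w F(q - e') + F(q + u)).
    It does not increase when q is replaced by q + e, since multiplication by
    y2 is onto, and it is positive: otherwise Nakayama would give
    F(q) = w F(q - e'), whereas a power of y2 that is a multiple of w
    contradicts the regularity of y1 = x_i w, y2.  An affine function that
    starts at 0 and ends positive cannot be eventually nonincreasing.

    Lengths are maximal lengths of chains of ideals; the only isomorphisms
    needed are the ones induced by multiplication by an element
    (len_mulsum). *)

Set Implicit Arguments.
Unset Strict Implicit.
Unset Printing Implicit Defensive.

Import Order.TTheory GRing.Theory Num.Theory.
Local Open Scope classical_set_scope.
Local Open Scope ring_scope.

(** * Ideals as sets *)

Section IdealCalculus.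
Variable R : comNzRingType.
Implicit Types (A B C X Y : set R) (a b c y z : R).

Definition idsum A B : set R := [set z | exists a b, [/\ A a, B b & z = a + b]].
Definition mulsum y B C : set R :=
  [set z | exists b c, [/\ B b, C c & z = y * b + c]].
Definition colon A y : set R := [set a | A (y * a)].
(* The colon ideal A : (a, b). *)
Definition colon2 A y z : set R := colon A y `&` colon A z.

Lemma ideal0 A : is_ideal A -> A 0. Proof. by case. Qed.
Lemma idealD A a b : is_ideal A -> A a -> A b -> A (a + b).
Proof. by case=> _ h _; exact: h. Qed.
Lemma ideal_mull A a b : is_ideal A -> A b -> A (a * b).
Proof. by case=> _ _; exact. Qed.
Lemma ideal_mulr A a b : is_ideal A -> A a -> A (a * b).
Proof. by rewrite mulrC; exact: ideal_mull. Qed.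
Lemma idealN A a : is_ideal A -> A a -> A (- a).
Proof. by rewrite -mulN1r; exact: ideal_mull. Qed.
Lemma idealB A a b : is_ideal A -> A a -> A b -> A (a - b).
Proof. by move=> hA Aa Ab; apply: idealD => //; exact: idealN. Qed.
Lemma ideal_sum A (T : Type) (r : seq T) (Q : pred T) (f : T -> R) :
  is_ideal A -> (forall i, Q i -> A (f i)) -> A (\sum_(i <- r | Q i) f i).
Proof.
move=> hA hf; apply: big_ind => //; first exact: ideal0.
by move=> a b; exact: idealD.
Qed.
Lemma ideal_sum_seq A (T : eqType) (r : seq T) (f : T -> R) :
  is_ideal A -> (forall i, i \in r -> A (f i)) -> A (\sum_(i <- r) f i).
Proof. by move=> hA hf; rewrite big_seq; apply: ideal_sum. Qed.

Lemma is_idealT : is_ideal [set: R]. Proof. by []. Qed.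
Lemma is_idealI A B : is_ideal A -> is_ideal B -> is_ideal (A `&` B).
Proof.
move=> hA hB; split; first by split; exact: ideal0.
  by move=> a b [? ?] [? ?]; split; exact: idealD.
by move=> a b [? ?]; split; exact: ideal_mull.
Qed.
Lemma is_ideal_colon A y : is_ideal A -> is_ideal (colon A y).
Proof.
move=> hA; split; rewrite /colon /=.
- by rewrite mulr0; exact: ideal0.
- by move=> a b Aa Ab; rewrite mulrDr; exact: idealD.
by move=> a b Ab; rewrite mulrCA; exact: ideal_mull.
Qed.
Lemma is_ideal_colon2 A y z : is_ideal A -> is_ideal (colon2 A y z).
Proof. by move=> hA; apply: is_idealI; exact: is_ideal_colon. Qed.
Lemma is_ideal_mulsum y B C :
  is_ideal B -> is_ideal C -> is_ideal (mulsum y B C).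
Proof.
move=> hB hC; split.
- by exists 0, 0; split; rewrite ?mulr0 ?addr0 //; exact: ideal0.
- move=> _ _ [b [c [Bb Cc ->]]] [b' [c' [Bb' Cc' ->]]].
  exists (b + b'), (c + c'); split; [exact: idealD|exact: idealD|ring].
move=> a _ [b [c [Bb Cc ->]]].
exists (a * b), (a * c); split; [exact: ideal_mull|exact: ideal_mull|ring].
Qed.
Lemma idsumE A B : idsum A B = mulsum 1 A B.
Proof.
rewrite eqEsubset; split => z [a [b [Aa Bb ->]]]; exists a, b;
  by rewrite mul1r.
Qed.
Lemma is_ideal_idsum A B : is_ideal A -> is_ideal B -> is_ideal (idsum A B).
Proof. by rewrite idsumE; exact: is_ideal_mulsum. Qed.

Lemma sub_mulsumr y B C : is_ideal B -> C `<=` mulsum y B C.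
Proof. by move=> hB c Cc; exists 0, c; rewrite mulr0 add0r; split=> //; exact: ideal0. Qed.
Lemma mulsum_in y B C b : is_ideal C -> B b -> mulsum y B C (y * b).
Proof. by move=> hC Bb; exists b, 0; rewrite addr0; split=> //; exact: ideal0. Qed.
Lemma mulsum_min y B C X : is_ideal X ->
  (forall b, B b -> X (y * b)) -> C `<=` X -> mulsum y B C `<=` X.
Proof.
by move=> hX hB hC _ [b [c [Bb Cc ->]]]; apply: idealD => //; [exact: hB|exact: hC].
Qed.

Lemma ideal_of_is_ideal g : is_ideal (@ideal_of R g).
Proof.
split.
- by exists (fun _ => 0); rewrite big1 // => i _; rewrite mul0r.
- move=> _ _ [c ->] [d ->]; exists (fun i => c i + d i).
  by rewrite -big_split; apply: eq_bigr => i _; rewrite mulrDl.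
move=> a _ [c ->]; exists (fun i => a * c i).
by rewrite mulr_sumr; apply: eq_bigr => i _; rewrite mulrA.
Qed.

Lemma ideal_of_nil : @ideal_of R [::] = [set 0].
Proof.
rewrite eqEsubset; split=> z /=; first by move=> [c ->]; rewrite big_ord0.
by move=> ->; exact: ideal0 (ideal_of_is_ideal _).
Qed.

Lemma ideal_of_cons a g : ideal_of (a :: g) = mulsum a [set: R] (ideal_of g).
Proof.
rewrite eqEsubset; split=> z.
  move=> [c ->]; exists (c ord0), (\sum_(i < size g) c (lift ord0 i) * g`_i).
  rewrite big_ord_recl mulrC /=; split=> //.
  by exists (fun i => c (lift ord0 i)).
move=> [b [_ [_ [c ->] ->]]].
exists (fun i : 'I_(size g).+1 => if unlift ord0 i is Some j then c j else b).
rewrite big_ord_recl unlift_none mulrC /=; congr (_ + _).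
by apply: eq_bigr => i _; rewrite liftK.
Qed.

Lemma ideal_of1P a z : ideal_of [:: a] z <-> exists c, z = a * c.
Proof.
rewrite ideal_of_cons ideal_of_nil; split.
  by move=> [c [d [_ /= -> ->]]]; exists c; rewrite addr0.
by move=> [c ->]; exists c, 0; rewrite addr0.
Qed.

Lemma ideal_of2P a b z :
  ideal_of [:: a; b] z <-> exists c d, z = a * c + b * d.
Proof.
rewrite ideal_of_cons; split.
  by move=> [c [d [_ /ideal_of1P[d' ->] ->]]]; exists c, d'.
by move=> [c [d ->]]; exists c, (b * d); split=> //; apply/ideal_of1P; exists d.
Qed.

Lemma ideal_of_mem g a : a \in g -> @ideal_of R g a.
Proof.
elim: g => // b g IH; rewrite inE ideal_of_cons => /orP[/eqP ->|/IH ag].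
  by exists 1, 0; rewrite mulr1 addr0; split=> //; exact: ideal0 (ideal_of_is_ideal _).
exact: sub_mulsumr.
Qed.

Lemma ideal_mul_in A B a b : A a -> B b -> ideal_mul A B (a * b).
Proof.
move=> Aa Bb; exists [:: (a, b)]; last by rewrite big_seq1.
by move=> p; rewrite inE => /eqP ->.
Qed.

Lemma ideal_mul_min A B X : is_ideal X ->
  (forall a b, A a -> B b -> X (a * b)) -> ideal_mul A B `<=` X.
Proof.
move=> hX h _ [u hu ->]; apply: ideal_sum_seq => // p /hu [? ?]; exact: h.
Qed.

Lemma ideal_mul2P a b A z : is_ideal A ->
  ideal_mul (ideal_of [:: a; b]) A z <->
  exists c d, [/\ A c, A d & z = a * c + b * d].
Proof.
move=> hA; split.
  move=> [u hu ->]; rewrite big_seq.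
  apply: (big_ind (fun z => exists c d, [/\ A c, A d & z = a * c + b * d])).
  - by exists 0, 0; rewrite !mulr0 addr0; split=> //; exact: ideal0.
  - move=> _ _ [c [d [Ac Ad ->]]] [c' [d' [Ac' Ad' ->]]].
    exists (c + c'), (d + d'); split; [exact: idealD|exact: idealD|ring].
  move=> p /hu [/ideal_of2P[c [d ->]] Ap]; exists (c * p.2), (d * p.2).
  by split; [exact: ideal_mull|exact: ideal_mull|ring].
move=> [c [d [Ac Ad ->]]]; exists [:: (a, c); (b, d)].
  move=> p; rewrite !inE => /orP[] /eqP -> /=; split=> //;
  by apply: ideal_of_mem; rewrite !inE eqxx ?orbT.
by rewrite big_cons big_seq1.
Qed.

Lemma is_ideal_mul A B : is_ideal A -> is_ideal (ideal_mul A B).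
Proof.
move=> hA; split.
- by exists [::]; rewrite ?big_nil.
- move=> _ _ [u hu ->] [v hv ->]; exists (u ++ v); last by rewrite big_cat.
  by move=> p; rewrite mem_cat => /orP[/hu|/hv].
move=> r _ [u hu ->]; exists [seq (r * p.1, p.2) | p <- u].
  by move=> _ /mapP[p /hu[Ap Bp] ->]; split=> //; exact: ideal_mull.
by rewrite big_map mulr_sumr; apply: eq_bigr => p _; rewrite mulrA.
Qed.

End IdealCalculus.

(** * Lengths of intervals of ideals *)

Section Length.
Variable R : comNzRingType.
Implicit Types (A B C X Y : set R).

Definition between A B : set (set R) :=
  [set X | [/\ is_ideal X, A `<=` X & X `<=` B]].
Definition len A B : nat := xget 0%N (is_max_nat (is_chain (between A B))).
Definition finlen A B : Prop :=
  exists N, forall k, is_chain (between A B) k -> (k <= N)%N.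

Lemma colengthE A : colength A = len A setT.
Proof.
congr (xget _ (is_max_nat (is_chain _))); apply/predeqP => X; split.
  by move=> [hX AX]; split.
by move=> [hX AX _]; split.
Qed.

Lemma chain_map (P Q : set (set R)) (f : set R -> set R) k :
  (forall X, P X -> Q (f X)) ->
  (forall X Y, P X -> P Y -> X `<` Y -> f X `<` f Y) ->
  is_chain P k -> is_chain Q k.
Proof.
move=> PQ fmono [C [hP hlt]]; exists (f \o C); split=> i ik /=.
  by apply: PQ; exact: hP.
by apply: fmono; [exact: hP (ltnW ik)|exact: hP|exact: hlt].
Qed.

(** Recording the last member of a chain allows inductions in which the chain is
    prolonged, or its last member is enlarged without a gain in length. *)
Definition chain_to (P : set (set R)) (X : set R) (k : nat) : Prop :=
  exists C : nat -> set R, [/\ (forall i, (i <= k)%N -> P (C i)),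
    (forall i, (i < k)%N -> C i `<` C i.+1) & C k = X].

Lemma chain_toW P X k : chain_to P X k -> is_chain P k.
Proof. by move=> [C [? ? ?]]; exists C. Qed.

Lemma chain_to0 P X : P X -> chain_to P X 0.
Proof. by move=> PX; exists (fun=> X); split=> // -[]. Qed.

Lemma chain_toS P X Y k : P Y -> X `<` Y -> chain_to P X k -> chain_to P Y k.+1.
Proof.
move=> PY XY [C [hP hlt CX]]; exists (fun i => if (i <= k)%N then C i else Y).
split=> [i ik|i ik|]; last by rewrite ltnn.
  by case: ifP => // hi; exact: hP.
rewrite -ltnS ik; case: ifP => hi; first exact: hlt.
by have -> : i = k by [lia]; rewrite CX.
Qed.

(** Only the last member changes, so strictness below it survives. *)
Lemma chain_to_sub P X Y k : P Y -> X `<=` Y -> chain_to P X k -> chain_to P Y k.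
Proof.
move=> PY XY [C [hP hlt CX]]; exists (fun i => if (i < k)%N then C i else Y).
split=> [i ik|i ik|]; last by rewrite ltnn.
  by case: ifP => // hi; exact: hP (ltnW hi).
rewrite ik; case: ifP => hi; first exact: hlt.
have ik1 : i.+1 = k by lia.
have [h1 h2] := hlt _ ik; rewrite ik1 CX in h1 h2.
by split; [exact: subset_trans h1 XY|move=> YC; apply: h2; exact: subset_trans XY YC].
Qed.

Lemma len_max A B : is_ideal A -> A `<=` B -> finlen A B ->
  is_max_nat (is_chain (between A B)) (len A B).
Proof.
move=> hA AB [N hN].
suff [k hk] : exists k, is_max_nat (is_chain (between A B)) k.
  by apply: (@xgetPex _ 0%N); exists k.
have e0 : exists k, `[< is_chain (between A B) k >].
  by exists 0%N; apply/asboolP; apply: (@chain_toW _ A); apply: chain_to0; split.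
have bd k : `[< is_chain (between A B) k >] -> (k <= N)%N by move/asboolP/hN.
case: (ex_maxnP e0 bd) => k /asboolP hk hmax; exists k; split=> // k' hk'.
exact/hmax/asboolP.
Qed.

Lemma len_chain A B : is_ideal A -> A `<=` B -> finlen A B ->
  is_chain (between A B) (len A B).
Proof. by move=> ? ? /len_max[]. Qed.

Lemma chain_le_len A B k : is_ideal A -> A `<=` B -> finlen A B ->
  is_chain (between A B) k -> (k <= len A B)%N.
Proof. by move=> ? ? /len_max[] // _; exact. Qed.

Lemma chain_between_sub A B A' B' k : A `<=` A' -> B' `<=` B ->
  is_chain (between A' B') k -> is_chain (between A B) k.
Proof.
move=> AA BB; apply: (@chain_map _ _ id) => // X [? h1 h2]; split=> //.
  exact: subset_trans h1.
exact: subset_trans BB.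
Qed.

Lemma finlen_sub A B A' B' : A `<=` A' -> B' `<=` B -> finlen A B -> finlen A' B'.
Proof. by move=> AA BB [N hN]; exists N => k /(chain_between_sub AA BB)/hN. Qed.

(** The modular law: in a strict inclusion, the intersection with B or the sum
    with B grows strictly, so a chain from A to C splits into one below B and
    one above B. *)
Lemma chain_split A B C k : is_ideal A -> is_ideal B -> is_ideal C ->
  A `<=` B -> B `<=` C -> is_chain (between A C) k ->
  exists a b, [/\ (k <= a + b)%N, is_chain (between A B) a
                & is_chain (between B C) b].
Proof.
move=> hA hB hC AB BC [D [hP hlt]].
have inI i : (i <= k)%N -> between A B (D i `&` B).
  move=> /hP[hD AD DC]; split; [exact: is_idealI|by rewrite subsetI|].
  by move=> z [].
have inS i : (i <= k)%N -> between B C (idsum (D i) B).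
  move=> /hP[hD AD DC]; split; first exact: is_ideal_idsum.
    by move=> b Bb; exists 0, b; rewrite add0r; split=> //; exact: ideal0.
  by move=> _ [d [b [Dd Bb ->]]]; apply: idealD => //; [exact: DC|exact: BC].
suff H j : (j <= k)%N -> exists a b, [/\ (j <= a + b)%N,
    chain_to (between A B) (D j `&` B) a
    & chain_to (between B C) (idsum (D j) B) b].
  have [a [b [? /chain_toW ? /chain_toW ?]]] := H _ (leqnn k).
  by exists a, b.
elim: j => [|j IH] jk.
  by exists 0%N, 0%N; split=> //; apply: chain_to0; [exact: inI|exact: inS].
have [a [b [jab ha hb]]] := IH (ltnW jk).
have [DD nDD] := hlt _ jk.
have sI : D j `&` B `<=` D j.+1 `&` B by apply: setSI.
have sS : idsum (D j) B `<=` idsum (D j.+1) B.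
  by move=> _ [d [z [/DD Dd Bz ->]]]; exists d, z.
have [subI|nsubI] := pselect (D j.+1 `&` B `<=` D j `&` B); last first.
  exists a.+1, b; split; first by rewrite addSn ltnS.
    by apply: chain_toS ha; [exact: inI|split].
  by apply: chain_to_sub hb => //; exact: inS.
exists a, b.+1; split; first by rewrite addnS ltnS.
  by apply: chain_to_sub ha => //; exact: inI.
apply: chain_toS hb; [exact: inS|split=> // subS; apply: nDD => z Dz].
have [hDj _ _] := hP _ (ltnW jk); have [hDj1 _ _] := hP _ jk.
have [|d [t [Dd Bt zE]]] := subS z.
  by exists z, 0; rewrite addr0; split=> //; exact: ideal0.
have Dt : D j.+1 t.
  have -> : t = z - d by rewrite zE addrAC subrr add0r.
  by apply: idealB => //; exact: DD.
by rewrite zE; apply: idealD => //; have [] := subI t.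
Qed.

Lemma chain_cat A B C a b : A `<=` B -> B `<=` C ->
  is_chain (between A B) a -> is_chain (between B C) b ->
  is_chain (between A C) (a + b).
Proof.
move=> AB BC [D [hD ltD]] [E [hE ltE]].
have inE i : (i <= b)%N -> between A C (E i).
  by move=> /hE[? BE ?]; split=> //; exact: subset_trans BE.
suff H j : (j <= b)%N -> chain_to (between A C) (E j) (a + j).
  exact: chain_toW (H _ (leqnn b)).
elim: j => [|j IH] jb.
  rewrite addn0; apply: (@chain_to_sub _ (D a)); first exact: inE.
    have [_ _ DB] := hD _ (leqnn a); have [_ BE _] := hE _ (leq0n b).
    exact: subset_trans BE.
  exists D; split=> // i /hD[? ? DB]; split=> //; exact: subset_trans BC.
rewrite addnS; apply: chain_toS (IH (ltnW jb)); first exact: inE.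
exact: ltE.
Qed.

Lemma finlen_trans A B C : is_ideal A -> is_ideal B -> is_ideal C ->
  A `<=` B -> B `<=` C -> finlen A B -> finlen B C -> finlen A C.
Proof.
move=> hA hB hC AB BC [N hN] [M hM]; exists (N + M)%N => k.
move=> /(chain_split hA hB hC AB BC)[a [b [kab /hN aN /hM bM]]].
by apply: leq_trans kab _; exact: leq_add.
Qed.

Lemma len_add A B C : is_ideal A -> is_ideal B -> is_ideal C ->
  A `<=` B -> B `<=` C -> finlen A C -> len A C = (len A B + len B C)%N.
Proof.
move=> hA hB hC AB BC fAC.
have AC := subset_trans AB BC.
have fAB : finlen A B by apply: finlen_sub fAC.
have fBC : finlen B C by apply: finlen_sub fAC.
apply/eqP; rewrite eqn_leq; apply/andP; split.
  have [a [b [kab ca cb]]] := chain_split hA hB hC AB BC (len_chain hA AC fAC).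
  by apply: leq_trans kab (leq_add _ _); exact: chain_le_len.
by apply: chain_le_len => //; apply: (chain_cat AB BC); exact: len_chain.
Qed.

Lemma len0_eq A B : is_ideal A -> is_ideal B -> A `<=` B -> finlen A B ->
  len A B = 0%N -> A = B.
Proof.
move=> hA hB AB fAB l0; rewrite eqEsubset; split=> //; apply: contrapT => nBA.
suff : (1 <= len A B)%N by rewrite l0.
apply: chain_le_len => //; apply: (@chain_toW _ B).
by apply: (@chain_toS _ A); [split|split|apply: chain_to0; split].
Qed.

(** Multiplication by y induces an isomorphism from B modulo its part in C : y
    onto (y B + C) / C; on submodules it is X |-> y X + C. *)
Lemma chain_mulsum y B C k : is_ideal B -> is_ideal C ->
  is_chain (between (B `&` colon C y) B) k <->
  is_chain (between C (mulsum y B C)) k.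
Proof.
move=> hB hC; split.
  apply: (@chain_map _ _ (fun X => mulsum y X C)).
    move=> X [hX AX XB]; split; first exact: is_ideal_mulsum.
      exact: sub_mulsumr.
    by move=> _ [x [c [/XB ? ? ->]]]; exists x, c.
  move=> X Y [hX AX XB] [hY _ YB] [XY nYX]; split.
    by move=> _ [x [c [/XY ? ? ->]]]; exists x, c.
  move=> sub; apply: nYX => z Yz.
  have [x [c [Xx Cc zE]]] := sub _ (mulsum_in y hC Yz).
  rewrite -[z](subrK x); apply: idealD => //; apply: AX; split.
    by apply: idealB => //; [exact: YB|exact: XB].
  by rewrite /colon /= mulrBr zE addrAC subrr add0r.
apply: (@chain_map _ _ (fun Y => B `&` colon Y y)).
  move=> Y [hY CY _]; split; first by apply: is_idealI => //; exact: is_ideal_colon.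
    by move=> z [Bz Cz]; split=> //; exact: CY.
  by move=> z [].
move=> X Y [hX CX _] [hY CY YS] [XY nYX]; split.
  by move=> z [Bz Xz]; split=> //; exact: XY.
move=> sub; apply: nYX => z Yz.
have [b [c [Bb Cc zE]]] := YS _ Yz.
rewrite zE; apply: idealD => //; last exact: CX.
suff [] : (B `&` colon X y) b by [].
apply: sub; split=> //; rewrite /colon /=.
have -> : y * b = z - c by rewrite zE addrK.
by apply: idealB => //; exact: CY.
Qed.

Lemma len_mulsum y B C : is_ideal B -> is_ideal C ->
  len C (mulsum y B C) = len (B `&` colon C y) B.
Proof.
move=> hB hC; congr (xget _ (is_max_nat _)); apply/predeqP => k.
by split=> /(chain_mulsum y k hB hC).
Qed.

Lemma finlen_mulsum y B C : is_ideal B -> is_ideal C ->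
  finlen (B `&` colon C y) B -> finlen C (mulsum y B C).
Proof. by move=> hB hC [N hN]; exists N => k /(chain_mulsum y k hB hC)/hN. Qed.

(** When g is nilpotent modulo A, every quotient of consecutive members of
    A + g^k R <= ... <= A + g R <= R is a quotient of R / (A + g R). *)
Lemma finlen_nilpotent A g k : is_ideal A -> A (g ^+ k) ->
  finlen (mulsum g setT A) setT -> finlen A setT.
Proof.
move=> hA Agk fin.
pose G j := mulsum (g ^+ j) setT A.
have hG j : is_ideal (G j) by apply: is_ideal_mulsum.
have -> : A = G k.
  rewrite eqEsubset; split; first exact: sub_mulsumr.
  by apply: mulsum_min => // b _; exact: ideal_mulr.
elim: k {Agk} => [|k IH].
  exists 0%N => -[//|j] [C [hP hlt]]; have [_] := hlt 0%N isT; case=> z _.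
  have [hC GC _] := hP 0%N isT; apply: GC.
  by exists z, 0; rewrite mul1r addr0; split=> //; exact: ideal0.
have GS : G k.+1 `<=` G k.
  apply: mulsum_min => //; last exact: sub_mulsumr.
  by move=> b _; rewrite exprSr -mulrA; exact: mulsum_in.
apply: (@finlen_trans _ (G k)) => //.
have -> : G k = mulsum (g ^+ k) setT (G k.+1).
  rewrite eqEsubset; split.
    apply: mulsum_min; [exact: is_ideal_mulsum|by move=> b _; exact: mulsum_in|].
    by move=> z Az; apply: sub_mulsumr => //; exact: sub_mulsumr.
  by apply: mulsum_min => // b _; exact: mulsum_in.
apply: finlen_mulsum => //; apply: finlen_sub fin => //.
rewrite setTI => _ [b [c [_ Ac ->]]]; exists b, (g ^+ k * c); split=> //.
  exact: ideal_mull.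
by rewrite exprSr; ring.
Qed.

End Length.

(** * Noetherian local rings and regular sequences *)

Section LocalRing.
Variables (R : comNzRingType) (m : set R).
Hypothesis (noethR : noetherian R) (locR : is_local m).
Implicit Types (A B C N : set R) (a b c y z : R) (g : seq R).

Let hm : is_ideal m. Proof. by case: locR => -[]. Qed.

(** A nonunit lies in a maximal ideal by Zorn's lemma, hence in m. *)
Lemma local_unit a : ~ m a -> exists b, a * b = 1.
Proof.
have [[_ m1 mmax] muniq] := locR.
move=> nma; apply: contrapT => nunit.
(* the empty set is included so that the empty family has an upper bound *)
pose P X := X = set0 \/ [/\ is_ideal X, ~ X 1 & X a].
have [F FP Ftot|M [PM Mmax]] := @Zorn_bigcup R P.
  have [[X FX X0]|nX] := pselect (exists2 X, F X & X !=set0); last first.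
    left; rewrite eqEsubset; split=> // z [X FX Xz].
    by apply: nX; exists X => //; exists z.
  have idX Y z : F Y -> Y z -> [/\ is_ideal Y, ~ Y 1 & Y a].
    by move=> /FP[->|].
  have [z Xz] := X0; have [hX X1 Xa] := idX _ _ FX Xz.
  right; split; last by exists X.
  - split; first by exists X => //; exact: ideal0.
      move=> b c [Y FY Yb] [Z FZ Zc].
      have [hY _ _] := idX _ _ FY Yb; have [hZ _ _] := idX _ _ FZ Zc.
      have [YZ|ZY] := Ftot _ _ FY FZ.
        by exists Z => //; apply: idealD => //; exact: YZ.
      by exists Y => //; apply: idealD => //; exact: ZY.
    move=> b c [Y FY Yc]; have [hY _ _] := idX _ _ FY Yc.
    by exists Y => //; exact: ideal_mull.
  - by move=> [Y FY Y1]; have [] := idX _ _ FY Y1.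
have Pa : P (ideal_of [:: a]).
  right; split; [exact: ideal_of_is_ideal| |exact: ideal_of_mem (mem_head _ _)].
  by move=> /ideal_of1P[c /esym ac]; apply: nunit; exists c.
have [M0|[hM M1 Ma]] := PM.
  apply: (Mmax (ideal_of [:: a])) => //; rewrite M0.
  by split=> // /(_ a); apply; exact: ideal_of_mem (mem_head _ _).
apply: nma; rewrite -(muniq M) //; split=> // X hX X1 MX.
apply: contrapT => XM; apply: (Mmax X); last first.
  by right; split=> //; exact: MX.
by split=> // XM'; apply: XM; rewrite eqEsubset.
Qed.

Lemma local_unit1B a : m a -> exists b, (1 - a) * b = 1.
Proof.
move=> ma; apply: local_unit => m1a; have [[_ m1 _] _] := locR; apply: m1.
by rewrite -(subrK a 1); exact: idealD.
Qed.

(** Induction on the number of generators of N: the first one is eliminated by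
    inverting a unit 1 - u with u in m. *)
Lemma nakayama N C : is_ideal N -> is_ideal C ->
  N `<=` idsum C (ideal_mul m N) -> N `<=` C.
Proof.
move=> /noethR[g ->] hC; elim: g => [|a g IH].
  by rewrite ideal_of_nil => _ _ ->; exact: ideal0.
have hg := ideal_of_is_ideal g; rewrite ideal_of_cons.
set N' := ideal_of g in IH hg *; move=> sub.
have hmN' : is_ideal (ideal_mul m N') by exact: is_ideal_mul.
have hS : is_ideal (idsum C (ideal_mul m N')) by exact: is_ideal_idsum.
have mN : ideal_mul m (mulsum a setT N') `<=` mulsum a m (ideal_mul m N').
  apply: ideal_mul_min; first exact: is_ideal_mulsum.
  move=> u _ mu [b [c [_ Nc ->]]]; exists (u * b), (u * c).
  by split; [exact: ideal_mulr|exact: ideal_mul_in|ring].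
have aS : idsum C (ideal_mul m N') a.
  have [|c [_ [Cc /mN[u [v [mu Nv ->]]] aE]]] := sub a.
    by exists 1, 0; rewrite mulr1 addr0; split=> //; exact: ideal0.
  have [b bE] := local_unit1B mu.
  have e : (1 - u) * a = c + v by rewrite mulrBl mul1r {1}aE; ring.
  have -> : a = b * (c + v) by rewrite -e mulrA [b * _]mulrC bE mul1r.
  by apply: ideal_mull => //; exists c, v.
have N'C : N' `<=` C.
  apply: IH => z N'z; have [|c [_ [Cc /mN[u [v [mu Nv ->]]] ->]]] := sub z.
    exact: sub_mulsumr.
  rewrite addrCA; apply: idealD => //; first exact: ideal_mulr.
  by exists c, v.
have mN'C : ideal_mul m N' `<=` C.
  by apply: ideal_mul_min => // u z _ /N'C; exact: ideal_mull.
apply: mulsum_min => // b _; apply: ideal_mulr => //.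
by have [c [v [Cc /mN'C Cv ->]]] := aS; exact: idealD.
Qed.

Lemma finlen_max : finlen m setT.
Proof.
have [[_ m1 mmax] _] := locR.
exists 1%N => -[|[|k]] // [C [hP hlt]].
have [hC0 mC0 _] := hP 0%N isT; have [hC1 mC1 _] := hP 1%N isT.
have [_ n01] := hlt 0%N isT; have [_ n12] := hlt 1%N isT.
have [C11|nC11] := pselect (C 1%N 1).
  by case: n12 => z _; rewrite -[z]mulr1; exact: ideal_mull.
by case: n01; rewrite (mmax _ hC1 nC11 mC1).
Qed.

(** The generators of m are nilpotent modulo A; adjoining them to A one by one
    leads to an ideal that contains m. *)
Lemma finlen_mprimary A : is_ideal A -> m `<=` radical A -> finlen A setT.
Proof.
move=> hA mA; have [g mE] := noethR hm.
have gA a : a \in g -> exists k, A (a ^+ k).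
  by move=> ag; apply: mA; rewrite mE; exact: ideal_of_mem.
have : finlen (idsum A (ideal_of g)) setT.
  apply: finlen_sub finlen_max => // z mz; exists 0, z.
  by rewrite add0r -mE; split=> //; exact: ideal0.
move: hA gA; rewrite {mA mE}; elim: g A => [|a g IH] A hA gA fin.
  apply: finlen_sub fin => //; rewrite ideal_of_nil.
  by move=> _ [z [_ [Az -> ->]]]; rewrite addr0.
have [k Ak] := gA a (mem_head _ _).
apply: (finlen_nilpotent hA Ak); apply: IH; first exact: is_ideal_mulsum.
  move=> b bg; have [|l Al] := gA b; first by rewrite inE bg orbT.
  by exists l; exact: sub_mulsumr.
apply: finlen_sub fin => //; rewrite ideal_of_cons.
move=> _ [z [_ [Az [b [c [_ gc ->]]] ->]]]; exists (a * b + z), c; split=> //; last by ring.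
by exists b, z.
Qed.

Definition regular2 a b : Prop :=
  (forall z, a * z = 0 -> z = 0) /\
  (forall z t, b * z = a * t -> exists z', z = a * z').

Lemma regular2_exp a b p q : regular2 a b -> regular2 (a ^+ p) (b ^+ q).
Proof.
move=> [rega regb].
have regap z : a ^+ p * z = 0 -> z = 0.
  elim: p z => [|p IH] z; first by rewrite mul1r.
  by rewrite exprS -mulrA => /rega/IH.
split=> // z t.
have regbp : forall z t, b * z = a ^+ p * t -> exists z', z = a ^+ p * z'.
  elim: {z t regap} p => [|p IH] z t; first by exists z; rewrite mul1r.
  rewrite exprS -mulrA => e; have [z' zE] := regb _ _ e.
  have [|w z'E] := IH z' t.
    by apply/eqP; rewrite -subr_eq0; apply/eqP/rega; rewrite mulrBr -e zE; ring.
  by exists w; rewrite zE z'E mulrA.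
elim: q z t => [|q IH] z t; first by rewrite mul1r => ->; exists t.
rewrite exprS -mulrA => /regbp[z' /IH]; exact.
Qed.

(** The first Koszul homology of y1, y2 is killed by the ideal they generate;
    if that ideal contains a regular sequence a, b then a syzygy c is killed by
    a and b modulo the trivial one, and regularity of a, b makes it trivial. *)
Lemma koszul_exact y1 y2 a b c1 c2 :
  ideal_of [:: y1; y2] a -> ideal_of [:: y1; y2] b -> regular2 a b ->
  y1 * c1 + y2 * c2 = 0 -> exists t, c1 = - (t * y2) /\ c2 = t * y1.
Proof.
move=> /ideal_of2P[a1 [a2 aE]] /ideal_of2P[b1 [b2 bE]] [rega regb] cyc.
pose ta := a1 * c2 - a2 * c1; pose tb := b1 * c2 - b2 * c1.
have cyc1 : y1 * c1 = - (y2 * c2) by apply/eqP; rewrite -addr_eq0 cyc.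
have Ea1 : a * c1 = - (ta * y2) by rewrite aE /ta; ring: cyc1.
have Ea2 : a * c2 = ta * y1 by rewrite aE /ta; ring: cyc1.
have Eb1 : b * c1 = - (tb * y2) by rewrite bE /tb; ring: cyc1.
have Eb2 : b * c2 = tb * y1 by rewrite bE /tb; ring: cyc1.
have tt : b * ta = a * tb.
  apply/eqP; rewrite -subr_eq0; apply/eqP/rega; rewrite {1}aE.
  have K1 : y1 * (b * ta - a * tb) = 0.
    by rewrite mulrBr !(mulrCA y1) ![y1 * _]mulrC -Ea2 -Eb2; ring.
  have K2 : y2 * (b * ta - a * tb) = 0.
    have -> : y2 * (b * ta - a * tb) = - (b * - (ta * y2) - a * - (tb * y2)) by ring.
    by rewrite -Ea1 -Eb1; ring.
  have -> : (y1 * a1 + y2 * a2) * (b * ta - a * tb) =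
    a1 * (y1 * (b * ta - a * tb)) + a2 * (y2 * (b * ta - a * tb)) by ring.
  by rewrite K1 K2 !mulr0 addr0.
have [t tE] := regb _ _ tt; exists t.
split; apply/eqP; rewrite -subr_eq0; apply/eqP/rega; rewrite mulrBr.
  by rewrite Ea1 tE; ring.
by rewrite Ea2 tE; ring.
Qed.

(** Exactness of the Koszul complex in degree one makes the annihilator of y1
    equal to y2 times itself, so Nakayama applies to it. *)
Lemma regular2_system y1 y2 a b : m y2 ->
  ideal_of [:: y1; y2] a -> ideal_of [:: y1; y2] b -> regular2 a b ->
  regular2 y1 y2.
Proof.
move=> my2 Ja Jb reg; have exact := koszul_exact Ja Jb reg; split; last first.
  move=> z t e; have [|u [_ ->]] := exact (- t) z; first by rewrite e; ring.
  by exists u; rewrite mulrC.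
pose N := colon [set 0] y1.
have h0 : is_ideal [set 0 : R] by rewrite -ideal_of_nil; exact: ideal_of_is_ideal.
suff N0 : N `<=` [set 0] by move=> z /N0.
apply: nakayama => //; first exact: is_ideal_colon.
move=> z y1z; have [|t [zE y1t]] := exact z 0; first by rewrite mulr0 addr0.
exists 0, z; rewrite add0r; split=> //; rewrite zE -mulNr mulrC.
by apply: ideal_mul_in => //; rewrite /N /colon /= mulrN mulrC -y1t oppr0.
Qed.

End LocalRing.

(** * Multiplication by an ideal with two generators *)

Section TwoGenerated.
Variable R : comNzRingType.

(** The syzygies of y1, y2 are trivial, so J/JA is the quotient of (R/A)^2 by a
    copy of R/(A : J).  Filtering J/JA by y1 R + JA turns this count into one
    on ideals. *)
Lemma colength_mul2 (y1 y2 : R) (A : set R) : regular2 y1 y2 -> is_ideal A ->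
  finlen (ideal_mul (ideal_of [:: y1; y2]) A) setT ->
  (colength (ideal_mul (ideal_of [:: y1; y2]) A) + colength (colon2 A y1 y2)
   = colength (ideal_of [:: y1; y2]) + (colength A).*2)%N.
Proof.
move=> [reg1 reg2] hA; set J := ideal_of _; set JA := ideal_mul J A => fin.
have hJ : is_ideal J by exact: ideal_of_is_ideal.
have hJA : is_ideal JA by exact: is_ideal_mul.
have hA1 : is_ideal (colon A y1) by exact: is_ideal_colon.
have hA12 : is_ideal (colon2 A y1 y2) by exact: is_ideal_colon2.
have JAA : JA `<=` A by apply: ideal_mul_min => // a b _; exact: ideal_mull.
have AA1 : A `<=` colon A y1 by move=> z; exact: ideal_mull.
have AA12 : A `<=` colon2 A y1 y2 by move=> z Az; split; exact: ideal_mull.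
have A12A1 : colon2 A y1 y2 `<=` colon A y1 by move=> z [].
(* the filtration JA <= S = y1 R + JA <= J *)
pose S := mulsum y1 setT JA; have hS : is_ideal S by exact: is_ideal_mulsum.
have JAS : JA `<=` S by exact: sub_mulsumr.
have JE : J = mulsum y2 setT S.
  apply/predeqP => z; split.
    move=> /ideal_of2P[c [d ->]]; exists d, (y1 * c); rewrite addrC; split=> //.
    exact: mulsum_in.
  move=> [b [_ [_ [c [u [_ JAu ->]]] ->]]]; rewrite addrA; apply: idealD => //.
    by apply/ideal_of2P; exists c, b; rewrite addrC.
  by apply: ideal_mul_min JAu => // p q Jp _; exact: ideal_mulr.
have SJ : S `<=` J by rewrite JE; exact: sub_mulsumr.
pose A' := mulsum y1 setT A; have hA' : is_ideal A' by exact: is_ideal_mulsum.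
have AA' : A `<=` A' by exact: sub_mulsumr.
have SyE : colon S y2 = A'.
  apply/predeqP => z; split.
    move=> [b [u [_ /(ideal_mul2P _ _ _ hA)[c [d [Ac Ad ->]]] e]]].
    have [|t zE] := reg2 (z - d) (b + c); first by rewrite mulrBr e; ring.
    by exists t, d; rewrite -zE subrK.
  move=> [b [c [_ Ac ->]]]; exists (y2 * b), (y2 * c); split=> //; last by ring.
  by apply: ideal_mul_in => //; apply: ideal_of_mem; rewrite !inE eqxx orbT.
pose B := mulsum y2 (colon A y1) A; have hB : is_ideal B by exact: is_ideal_mulsum.
have AB : A `<=` B by exact: sub_mulsumr.
have JAyE : colon JA y1 = B.
  apply/predeqP => z; split.
    move=> /(ideal_mul2P _ _ _ hA)[c [d [Ac Ad e]]].
    have [|t dE] := reg2 d (z - c); first by rewrite mulrBr e; ring.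
    exists t, c; split=> //; first by rewrite /colon /= -dE.
    apply/eqP; rewrite -subr_eq0; apply/eqP/reg1; rewrite mulrBr e dE; ring.
  move=> [b [c [Ab Ac ->]]]; apply/ideal_mul2P => //; exists c, (y1 * b).
  by split=> //; ring.
have sub X : A `<=` X -> finlen X setT.
  by move=> AX; apply: finlen_sub fin => //; exact: subset_trans AX.
have fA : finlen A setT by exact: sub.
rewrite !colengthE.
have E1 : len JA setT = (len JA S + (len S J + len J setT))%N.
  rewrite -len_add //; last by apply: finlen_sub fin.
  by rewrite -len_add.
(* J/S = R/(y1 R + A) and S/JA = R/(y2 (A : y1) + A); both are compared with R/A *)
have E2 : len S J = len A' setT by rewrite JE len_mulsum // setTI SyE.
have E3 : len A setT = (len (colon A y1) setT + len A' setT)%N.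
  by rewrite (len_add hA hA') // len_mulsum // setTI.
have E4 : len JA S = len B setT by rewrite len_mulsum // setTI JAyE.
have E5 : len A setT = (len (colon2 A y1 y2) (colon A y1) + len B setT)%N.
  by rewrite (len_add hA hB) // len_mulsum.
have E6 : len (colon2 A y1 y2) setT =
    (len (colon2 A y1 y2) (colon A y1) + len (colon A y1) setT)%N.
  by rewrite -len_add //; exact: sub.
lia.
Qed.

End TwoGenerated.

(** * Vectors and Laurent monomials *)

Section VectorArithmetic.
Variable s : nat.
Implicit Types (n p : vec s).

Definition vunit (i : 'I_s) : vec s := [ffun j => (j == i)%:R].

Lemma vaddE n p i : (n + p) i = n i + p i. Proof. by rewrite ffunE. Qed.
Lemma voppE n i : (- n) i = - n i. Proof. by rewrite ffunE. Qed.
Lemma v0E i : (0 : vec s) i = 0. Proof. by rewrite ffunE. Qed.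
Lemma voneE i : (vone : vec s) i = 1. Proof. by rewrite ffunE. Qed.
Lemma vunitE i j : vunit i j = (j == i)%:R. Proof. by rewrite ffunE. Qed.
Lemma vmulnE n k i : (n *+ k) i = n i *+ k.
Proof. by elim: k => [|k IH]; rewrite ?mulr0n ?v0E // !mulrS vaddE IH. Qed.
Definition vE := (vaddE, voppE, v0E, voneE, vunitE, vmulnE).

End VectorArithmetic.

Section LaurentMonomials.
Variables (R : comNzRingType) (s : nat).
Implicit Types (f g : laurent R s) (n p : vec s) (c d : R).
Local Notation L := (laurent R s : comNzRingType).

Lemma lcoef_monom c n : lcoef (monom c n) n = c.
Proof. by rewrite /lcoef /monom mcoeffUU. Qed.

Lemma homogeneous_monom c n : homogeneous n (monom c n).
Proof.
by move=> p pn; rewrite /lcoef /monom mcoeffU eq_sym (negbTE pn).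
Qed.

Lemma homogeneousE n f : homogeneous n f -> f = monom (lcoef f n) n.
Proof.
move=> hf; apply/malgP => p; rewrite [RHS]mcoeffU.
have [<-|np] := eqVneq n p; first by rewrite mulr1n.
by rewrite mulr0n; apply: hf; rewrite eq_sym.
Qed.

Lemma monom0 n : monom 0 n = 0 :> L. Proof. exact: monalgU0. Qed.

Lemma monomB c d n : monom c n - monom d n = monom (c - d) n :> L.
Proof. by rewrite /monom monalgUB. Qed.

Lemma monomM c d n p : (monom c n : L) * monom d p = monom (c * d) (n + p).
Proof.
change (lmul (monom c n) (monom d p) = monom (c * d) (n + p)).
have [->|c0] := eqVneq c 0.
  by rewrite mul0r !monom0 /lmul msupp0 big_seq_fset0.
have [->|d0] := eqVneq d 0.
  rewrite mulr0 !monom0 /lmul msupp0 big1 // => i _.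
  by rewrite big_seq_fset0.
rewrite /lmul /monom !msuppU (negbTE c0) (negbTE d0).
by rewrite !big_seq_fset1 !mcoeffUU.
Qed.

Lemma monomX c n k : (monom c n : L) ^+ k = monom (c ^+ k) (n *+ k).
Proof.
by elim: k => // k IH; rewrite !exprS IH monomM mulrS.
Qed.

Lemma graded_sum_from_monom (G : vec s -> set R) n0 n c :
  (forall p, is_ideal (G p)) -> vle n0 n -> G n c ->
  graded_sum_from n0 G (monom c n).
Proof.
move=> hG n0n Gc; split=> p; have [->|pn] := eqVneq p n.
- by rewrite lcoef_monom.
- by rewrite homogeneous_monom //; exact: ideal0.
- by [].
by rewrite homogeneous_monom // eqxx.
Qed.

End LaurentMonomials.

(** The annihilator of z is an ideal, hence so is its radical. *)
Lemma nilpotent_comb (L : comNzRingType) (k : nat) (a x : 'I_k -> L) (z : L) :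
  (forall i, exists l, x i ^+ l * z = 0) ->
  exists l, (\sum_(i < k) a i * x i) ^+ l * z = 0.
Proof.
move=> hx; apply: (big_ind (fun u => exists l, u ^+ l * z = 0)).
- by exists 1%N; rewrite mul0r.
- move=> u v [p up] [q vq]; exists (p + q)%N; rewrite exprDn mulr_suml big1 // => i _.
  rewrite mulrnAl; have [ip|ip] := leqP i q.
    have -> : (p + q - i = q - i + p)%N by lia.
    by rewrite exprD -!mulrA [v ^+ i * z]mulrC (mulrA _ z) up mul0r mulr0 mul0rn.
  have -> : (i = i - q + q :> nat)%N by lia.
  by rewrite exprD -!mulrA vq !mulr0 mul0rn.
by move=> i _; have [l xl] := hx i; exists l; rewrite exprMn -mulrA xl mulr0.
Qed.

(** * Filtrations with a good complete reduction *)

Lemma ideal_pow_exp (R : comNzRingType) (I : set R) (a : R) k :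
  I a -> ideal_pow I k (a ^+ k).
Proof.
move=> Ia; elim: k => // k IH; rewrite exprS; exact: ideal_mul_in.
Qed.

Lemma colength_inj (R : comNzRingType) (A B : set R) : is_ideal A -> is_ideal B ->
  A `<=` B -> finlen A setT -> colength A = colength B -> A = B.
Proof.
move=> hA hB AB fA; rewrite !colengthE (len_add hA hB) // => e.
by apply: len0_eq => //; [exact: finlen_sub fA|lia].
Qed.

Lemma len_antimono (R : comNzRingType) (A A' B : set R) :
  is_ideal A -> is_ideal A' -> is_ideal B -> A `<=` A' -> A' `<=` B ->
  finlen A B -> (len A' B <= len A B)%N.
Proof. by move=> hA hA' hB AA AB f; rewrite (len_add hA hA') // leq_addl. Qed.

(** Both fractions f u^l / u^l and f v^l / v^l represent f. *)
Lemma frac_eq_const (L : comNzRingType) (u v f : L) l :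
  frac_eq (u * v) (v ^+ l * (f * u ^+ l), l) (u ^+ l * (f * v ^+ l), l).
Proof. by exists 0%N => /=; ring. Qed.

Lemma frac_eq_constE (L : comNzRingType) (u f g : L) l k :
  u ^+ k * (u ^+ l * f - u ^+ 0 * (g * u ^+ l)) = 0 -> u ^+ (k + l) * (f - g) = 0.
Proof. by move=> <-; rewrite exprD; ring. Qed.

Section Filtration.
Variables (R : comNzRingType) (m : set R) (s : nat).
Variables (I : 'I_s -> set R) (F : vec s -> set R) (x : 'I_s -> 'I_2 -> R).
Hypotheses (noethR : noetherian R) (locR : is_local m) (depth2 : depth m 2).
Hypothesis s_ge2 : (2 <= s)%N.
Hypothesis Iprim : forall i, is_mprimary m (I i).
Hypothesis Ffilt : is_filtration I F.
Hypothesis xgood : is_good_complete_reduction x I F.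
Implicit Types (n p q : vec s) (a b c : R) (A : set R).

Local Notation y1 := (yprod x ord0).
Local Notation y2 := (yprod x ord_max).
Local Notation J := (Jideal x).
Local Notation e := (@vone s).
Local Notation L := (laurent R s : comNzRingType).
Local Notation H := (hilbert_fun F).

Lemma max_ideal : is_ideal m. Proof. by case: locR => -[]. Qed.
Lemma F_ideal n : is_ideal (F n). Proof. by case: Ffilt. Qed.
Lemma F_mul n p a b : F n a -> F p b -> F (n + p) (a * b).
Proof. by case: Ffilt => _ _ h _ Fa Fb; apply: h; exact: ideal_mul_in. Qed.
Lemma F_le n p : vle n p -> F p `<=` F n.
Proof. by case: Ffilt => _ _ _; exact. Qed.

Lemma mpow_ideal n : is_ideal (mpow I n).
Proof.
apply: big_ind => // [A B hA _|i _]; first exact: is_ideal_mul.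
case: `|_|%N => [|k]; first exact: is_idealT.
by apply: is_ideal_mul; case: (Iprim i) => -[].
Qed.

Lemma mpow_prod n (z : 'I_s -> R) :
  (forall j, ideal_pow (I j) `|Num.max (n j) 0|%N (z j)) ->
  mpow I n (\prod_(j < s) z j).
Proof.
move=> hz; apply: (big_ind2 (fun (K : set R) a => K a)) => //.
by move=> K a L b; exact: ideal_mul_in.
Qed.

Lemma F_prod n (z : 'I_s -> R) :
  (forall j, ideal_pow (I j) `|Num.max (n j) 0|%N (z j)) ->
  F n (\prod_(j < s) z j).
Proof.
by move=> hz; case: Ffilt => _ IF _ _; exact/IF/mpow_prod.
Qed.

Lemma F_one : F 0 1.
Proof.
rewrite -[1](big1_eq _ _ : \prod_(j < s) 1 = 1).
by apply: F_prod => j; rewrite v0E.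
Qed.

Lemma F_exp n a k : F n a -> F (n *+ k) (a ^+ k).
Proof.
move=> Fa; elim: k => [|k IH]; first by rewrite mulr0n expr0; exact: F_one.
by rewrite mulrS exprS; exact: F_mul.
Qed.

(** Each I_j has radical m, and the exponents can be chosen separately for the
    finitely many factors of I^n. *)
Lemma F_radical n : m `<=` radical (F n).
Proof.
move=> a ma.
have /choice[k hk] : forall j, exists k, I j (a ^+ k).
  by move=> j; have [_ r] := Iprim j; move: ma; rewrite -r.
exists (\sum_(j < s) k j * `|Num.max (n j) 0|)%N; rewrite expr_sum.
by apply: F_prod => j; rewrite exprM; exact: ideal_pow_exp.
Qed.

Lemma F_finlen n : finlen (F n) setT.
Proof. by apply: (finlen_mprimary noethR locR); [exact: F_ideal|exact: F_radical]. Qed.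

Lemma I_max i : I i `<=` m.
Proof. by have [_ r] := Iprim i; move=> a Ia; rewrite -r; exists 1%N. Qed.

Lemma x_in i j : I i (x i j). Proof. by case: xgood => -[]. Qed.

Lemma x_pow1 i j : ideal_pow (I i) 1 (x i j).
Proof. by rewrite -[x i j]expr1; exact: ideal_pow_exp (x_in i j). Qed.

Lemma mpow_yprod j : mpow I e (yprod x j).
Proof. by apply: mpow_prod => i; rewrite voneE; exact: x_pow1. Qed.

Lemma F_yprod j : F e (yprod x j).
Proof. by case: Ffilt => _ IF _ _; exact/IF/mpow_yprod. Qed.

Lemma max_prod (Q : pred 'I_s) (j : 'I_s) k : Q j -> m (\prod_(i < s | Q i) x i k).
Proof.
move=> Qj; rewrite (bigD1 j) //=.
by apply: (ideal_mulr _ max_ideal); apply: I_max; exact: x_in.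
Qed.

Lemma max_yprod j : m (yprod x j).
Proof. exact: (@max_prod _ (Ordinal (ltnW s_ge2))). Qed.

Lemma J_ideal : is_ideal J. Proof. exact: ideal_of_is_ideal. Qed.

Lemma JF_ideal n : is_ideal (ideal_mul J (F n)).
Proof. by apply: is_ideal_mul; exact: J_ideal. Qed.

Lemma JF_sub n : ideal_mul J (F n) `<=` F (n + e).
Proof.
apply: ideal_mul_min; first exact: F_ideal.
move=> a b /ideal_of2P[c [d ->]] Fb; rewrite addrC; apply: F_mul => //.
by apply: (idealD (F_ideal _)); apply: (ideal_mulr _ (F_ideal _)); exact: F_yprod.
Qed.

Lemma large_reduction : exists N : nat, forall n, (forall i, N%:Z <= n i) ->
  ideal_mul J (F n) = F (n + e).
Proof. by case: xgood => -[]. Qed.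

Lemma J_radical : m `<=` radical J.
Proof.
have [N hN] := large_reduction; move=> a ma.
have [k] := @F_radical ([ffun=> N%:Z] + e) a ma.
rewrite -hN => [|i]; last by rewrite ffunE.
move=> h; exists k; apply: ideal_mul_min h; first exact: J_ideal.
by move=> b c Jb _; apply: (ideal_mulr _ J_ideal).
Qed.

Lemma JF_finlen n : finlen (ideal_mul J (F n)) setT.
Proof.
apply: (finlen_mprimary noethR locR); first exact: JF_ideal.
move=> a ma; have [k Jk] := J_radical ma; have [l Fl] := @F_radical n a ma.
by exists (k + l)%N; rewrite exprD; exact: ideal_mul_in.
Qed.

(** The depth provides a regular sequence a, b in m; powers of a and b lie in J
    and still form a regular sequence. *)
Lemma y_regular : regular2 y1 y2.
Proof.
have [[g [sz gm [greg _]]] _] := depth2.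
case: g sz gm greg => [|a [|b [|c g]]] // _ gm greg.
have regab : regular2 a b.
  split=> [z az0|z t bz].
    have := greg 0%N isT z; rewrite /= ideal_of_nil; exact.
  by have /ideal_of1P := greg 1%N isT z (proj2 (ideal_of1P _ _) (ex_intro _ t bz)).
have [k Jk] := J_radical (gm a (mem_head _ _)).
have [l Jl] : radical J b by apply/J_radical/gm; rewrite !inE eqxx orbT.
apply: (regular2_system noethR locR _ Jk Jl); first exact: max_yprod.
exact: regular2_exp.
Qed.

Lemma F_colon_yprod1 : exists N : nat, forall n, (forall i, N%:Z <= n i) ->
  forall a, F n (a * y1) -> F (n - e) a.
Proof.
have [_ [N hN]] := xgood; exists N => n nN a Fa.
have : (F n `&` ideal_of [:: y1]) (a * y1).
  by split=> //; apply/ideal_of1P; exists a; rewrite mulrC.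
rewrite hN // => -[b Fb ba]; have [reg _] := y_regular.
suff -> : a = b by [].
by apply/eqP; rewrite -subr_eq0; apply/eqP/reg; rewrite mulrBr ba mulrC subrr.
Qed.

Lemma F_sub_colon n : F n `<=` colon2 (F (n + e)) y1 y2.
Proof. by move=> a Fa; split; rewrite /colon /= mulrC; apply: F_mul => //; exact: F_yprod. Qed.

Lemma large_colon : exists N : nat, forall n, (forall i, N%:Z <= n i) ->
  colon2 (F n) y1 y2 = F (n - e).
Proof.
have [N hN] := F_colon_yprod1; exists N => n nN; rewrite eqEsubset; split.
  by move=> a [Fa _]; apply: hN => //; rewrite mulrC.
by rewrite -{2}(subrK e n); exact: F_sub_colon.
Qed.

(** Comparing J F(n) and F(n + e) by colength turns the reduction equality into
    a second difference equation for the Hilbert function. *)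
Lemma reduction_diff n : colon2 (F n) y1 y2 = F (n - e) ->
  ideal_mul J (F n) = F (n + e) <->
  (H (n + e)%R + H (n - e)%R = colength J + (H n).*2)%N.
Proof.
move=> cE; have := colength_mul2 y_regular (F_ideal n) (JF_finlen n).
rewrite -/J cE -/(H n) -/(H (n - e)) => <-; split=> [->//|/addIn h].
apply: colength_inj => //; [exact: JF_ideal|exact: F_ideal|exact: JF_sub|exact: JF_finlen].
Qed.

(** When a J lies in F(n + e), a F(q) lies in F(n + q) for all large q, so
    a t^n is a section over the complement of the irrelevant locus: the Cech
    cochain of the fractions a t^n u^l / u^l, u running over the generators, is
    a cocycle.  A section f of degree n that bounds it differs from a t^n by
    an element killed by a power of the irrelevant ideal, which contains the
    regular element y1 t^e. *)
Lemma colon_of_H1_zero n : vle 0 n ->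
  local_cohomology1_zero (Rees (mpow I)) (Rees_pp I) (Rees F) n ->
  colon2 (F (n + e)) y1 y2 = F n.
Proof.
move=> n0 [k [u [d [[uin ugen] udeg H1]]]]; rewrite eqEsubset; split; last exact: F_sub_colon.
move=> a [Fay1 Fay2]; have [N hN] := large_reduction.
have Fa q b : (forall i, N.+1%:Z <= q i) -> F q b -> F (n + q) (a * b).
  move=> qN; rewrite -[q](subrK e) -hN => [|i]; last first.
    by rewrite !vE; have := qN i; lia.
  move=> /(ideal_mul2P _ _ _ (F_ideal _))[c [f [Fc Ff ->]]].
  have -> : n + (q - e + e) = (n + e) + (q - e) by rewrite subrK addrACA subrr addr0.
  have -> : a * (y1 * c + y2 * f) = y1 * a * c + y2 * a * f by ring.
  by apply: (idealD (F_ideal _)); exact: F_mul.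
pose c i := lcoef (u i) (d i).
have uE i : u i = monom (c i) (d i) by exact: homogeneousE (udeg i).
have Fc i : F (d i) (c i).
  by case: Ffilt => _ IF _ _; apply: IF; have [/(_ (d i))] := uin i.
pose l := N.+1.
have tE i : (monom a n : L) * u i ^+ l = monom (a * c i ^+ l) (n + d i *+ l).
  by rewrite uE monomX monomM.
have [f [[fF _] fn feq]] :
    cech_coboundary1 (Rees F) u n (fun i => ((monom a n : L) * u i ^+ l, l)).
  apply: H1 => [i|i j ij]; last first.
    exact (@frac_eq_const L (u i) (u j) (monom a n) l).
  rewrite /= tE; split; last exact: homogeneous_monom.
  have [c0|c0] := eqVneq (c i) 0.
    rewrite c0 expr0n /= mulr0 monom0.
    by split=> p; rewrite /lcoef mcoeff0 ?eqxx //; exact: ideal0 (F_ideal _).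
  have dl j : N.+1%:Z <= (d i *+ l) j.
    have [_ /(_ _ c0)/(_ j)] := uin i; rewrite vmulnE voneE /l => h.
    by rewrite -mulr_natr; nia.
  apply: graded_sum_from_monom; [exact: F_ideal| |].
    by move=> j; rewrite vaddE v0E; have := n0 j; have := dl j; rewrite v0E; lia.
  by apply: Fa => //; exact: F_exp.
have [M hM] : exists M, (monom y1 e : L) ^+ M * (f - monom a n) = 0.
  have [|b _ ->] := ugen (monom y1 e).
    apply: graded_sum_from_monom.
  - exact: mpow_ideal.
  - by [].
  - exact: mpow_yprod.
  apply: nilpotent_comb => i; have [p hp] := feq i; exists (p + l)%N.
  exact: frac_eq_constE hp.
have fE := homogeneousE fn.
have aE : a = lcoef f n.
  apply/esym/eqP; rewrite -subr_eq0; apply/eqP.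
  have [reg _] : regular2 (y1 ^+ M) (y2 ^+ 0) by apply: regular2_exp; exact: y_regular.
  apply: reg; move: hM; rewrite fE monomB monomX monomM.
  by move=> /(congr1 (fun g => lcoef g (e *+ M + n))); rewrite !lcoef_monom /lcoef mcoeff0.
by rewrite aE.
Qed.

Section MixedDifference.
Variable i : 'I_s.
Let ui : vec s := vunit i.
Let e' : vec s := e - ui.
Let w : R := \prod_(j < s | j != i) x j ord0.

(** For large n the length of F n modulo this submodule is the mixed second
    difference of the Hilbert function in the directions ui and e'. *)
Definition mixed_sub n : set R := mulsum w (F (n - e')) (F (n + ui)).
Definition mixed_len n : nat := len (mixed_sub n) (F n).

Let y1E : y1 = x i ord0 * w. Proof. by rewrite /yprod (bigD1 i). Qed.

Let F_cofactor (k : 'I_2) : F e' (\prod_(j < s | j != i) x j k).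
Proof.
rewrite big_mkcond; apply: F_prod => j; rewrite !vE.
have [->|ji] := eqVneq j i; first by rewrite subrr.
by rewrite subr0; exact: x_pow1.
Qed.

Let F_w : F e' w. Proof. exact: F_cofactor. Qed.

Let F_ui (j : 'I_2) : F ui (x i j).
Proof.
have -> : x i j = \prod_(k < s) if k == i then x k j else 1.
  by rewrite -big_mkcond big_pred1_eq.
apply: F_prod => k; rewrite !vE; case: (k == i); first exact: x_pow1.
by rewrite maxxx.
Qed.

Let w_max : m w.
Proof.
have [j ji] : exists j : 'I_s, j != i.
  apply: contrapT => nj; have: (#|'I_s| <= 1)%N.
    apply/card_le1_eqP => j k _ _.
    have E l : l = i by apply: contrapT => /eqP li; apply: nj; exists l.
    by rewrite (E j) (E k).
  by rewrite card_ord leqNgt s_ge2.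
exact: max_prod ji.
Qed.

Let mixed_sub_ideal n : is_ideal (mixed_sub n).
Proof. by apply: is_ideal_mulsum; exact: F_ideal. Qed.

Let mixed_sub_F n : mixed_sub n `<=` F n.
Proof.
apply: mulsum_min => [|b Fb|]; first exact: F_ideal.
  by rewrite -[n](subrK e') addrC; exact: F_mul.
by apply: F_le => j; rewrite !vE; case: (_ == _); lia.
Qed.

Let F_sub_finlen n A : F n `<=` A -> finlen A setT.
Proof. by move=> FA; apply: finlen_sub (F_finlen n). Qed.

Let F_mixed_sub n : F (n + ui) `<=` mixed_sub n.
Proof. by apply: sub_mulsumr; exact: F_ideal. Qed.

(** Multiplication by w embeds F(n - e') / F(n - e' + ui) into F(n) / F(n + ui):
    if w a lies in F(n + ui), then y1 a = x_i w a lies in F(n + 2 ui), and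
    goodness puts a into F(n + 2 ui - e) = F(n - e' + ui). *)
Lemma large_mixed_len : exists N : nat, forall n, (forall j, N%:Z <= n j) ->
  (mixed_len n + H n + H (n - e' + ui)%R = H (n + ui)%R + H (n - e')%R)%N.
Proof.
have [N hN] := F_colon_yprod1; exists N => n nN.
rewrite /hilbert_fun !colengthE.
rewrite (len_add (F_ideal (n + ui)) (mixed_sub_ideal n)) //; last exact: F_finlen.
rewrite (len_add (mixed_sub_ideal n) (F_ideal n)) //; last exact: F_sub_finlen (@F_mixed_sub n).
rewrite (len_mulsum w (F_ideal _) (F_ideal _)).
have leui : F (n - e' + ui) `<=` F (n - e').
  by apply: F_le => j; rewrite !vE; case: (_ == _); lia.
have -> : F (n - e') `&` colon (F (n + ui)) w = F (n - e' + ui).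
  rewrite eqEsubset; split=> a.
    move=> [_ Fwa].
    have -> : n - e' + ui = n + ui + ui - e.
      by apply/ffunP => j; rewrite !vE; ring.
    apply: hN => [j|]; first by rewrite !vE; have := nN j; case: (_ == _); lia.
    have -> : a * y1 = w * a * x i ord0 by rewrite y1E; ring.
    exact: F_mul.
  move=> Fa; split; first exact: leui.
  rewrite /colon /=; have -> : n + ui = e' + (n - e' + ui).
    by rewrite addrA [e' + _]addrC subrK.
  exact: F_mul.
rewrite (len_add (F_ideal (n - e' + ui)) (F_ideal (n - e'))) //; last exact: F_finlen.
rewrite /mixed_len; lia.
Qed.

(** Length zero would give F(n) = w F(n - e') by Nakayama, so a power of y2
    would be a multiple of w.  Then y1 = x_i w divides x_i times that power,
    hence x_i itself by regularity; as w lies in m, this forces x_i = 0. *)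
Lemma large_mixed_len_gt0 : exists N : nat, forall n, (forall j, N%:Z <= n j) ->
  (0 < mixed_len n)%N.
Proof.
have [N hN] := large_reduction; exists N.+1 => n nN; rewrite lt0n; apply/eqP => l0.
have TF : mixed_sub n = F n.
  apply: len0_eq => //; first exact: F_ideal.
  by apply: (@finlen_sub _ (F (n + ui)) setT); [exact: F_mixed_sub| |exact: F_finlen].
pose W := mulsum w (F (n - e')) [set 0].
have h0 : is_ideal [set 0 : R] by rewrite -ideal_of_nil; exact: ideal_of_is_ideal.
have hW : is_ideal W by apply: is_ideal_mulsum => //; exact: F_ideal.
have hmF : is_ideal (ideal_mul m (F n)) by apply: is_ideal_mul; exact: max_ideal.
have F_mF : F (n + ui) `<=` ideal_mul m (F n).
  have -> : n + ui = n - e' + e by apply/ffunP => j; rewrite !vE; ring.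
  rewrite -hN => [|j]; last by rewrite !vE; have := nN j; case: (_ == _); lia.
  have Fy k b : F (n - e') b -> ideal_mul m (F n) (yprod x k * b).
    move=> Fb; rewrite /yprod (bigD1 i) //= -mulrA; apply: ideal_mul_in.
      by apply: I_max; exact: x_in.
    by rewrite -[n](subrK e') addrC; apply: F_mul.
  by move=> _ /(ideal_mul2P _ _ _ (F_ideal _))[b [c [Fb Fc ->]]]; apply: idealD => //; exact: Fy.
have FW : F n `<=` W.
  apply: (nakayama noethR locR (F_ideal n) hW) => a.
  rewrite -{1}TF => -[b [c [Fb /F_mF mc ->]]]; exists (w * b), c; split=> //.
  exact: mulsum_in.
have [k /FW[b [_ [_ -> e1]]]] := F_radical n (max_yprod ord_max).
have [reg1 reg2] := regular2_exp 1 k y_regular.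
have [|z zE] := reg2 (x i ord0) b.
  by rewrite e1 addr0 y1E expr1; ring.
have mwz : m (w * z) by apply: (ideal_mulr _ max_ideal).
have [v vE] := local_unit1B locR mwz.
have x0 : x i ord0 = 0.
  rewrite -[LHS]mulr1 -vE mulrA mulrBr mulr1 {1}zE expr1 y1E.
  by rewrite -mulrA subrr mul0r.
have := reg1 1; rewrite expr1 mulr1 y1E x0 mul0r => /(_ erefl)/eqP.
by rewrite oner_eq0.
Qed.

(** F(n + e) = y1 F(n) + y2 F(n), and y1 F(n) lies in w F(n + e - e'), so
    multiplication by y2 is onto. *)
Lemma large_mixed_len_le : exists N : nat, forall n, (forall j, N%:Z <= n j) ->
  (mixed_len (n + e)%R <= mixed_len n)%N.
Proof.
have [N hN] := large_reduction; exists N => n nN.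
set C := mixed_sub (n + e).
have hC : is_ideal C by exact: mixed_sub_ideal.
have wC b : F (n + e - e') b -> C (w * b) by apply: mulsum_in; exact: F_ideal.
have FE : F (n + e) = mulsum y2 (F n) C.
  rewrite eqEsubset; split.
    rewrite -hN // => _ /(ideal_mul2P _ _ _ (F_ideal _))[c [d [Fc Fd ->]]].
    exists d, (y1 * c); rewrite addrC; split=> //.
    rewrite y1E -mulrA mulrCA; apply: wC.
    have -> : n + e - e' = ui + n by apply/ffunP => j; rewrite !vE; ring.
    exact: F_mul.
  apply: mulsum_min => [|b Fb|]; [exact: F_ideal| |exact: mixed_sub_F].
  by rewrite addrC; apply: F_mul => //; exact: F_yprod.
rewrite /mixed_len FE -/C (len_mulsum y2 (F_ideal n) hC).
apply: len_antimono.
- exact: mixed_sub_ideal.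
- by apply: is_idealI; [exact: F_ideal|exact: is_ideal_colon].
- exact: F_ideal.
- move=> a Ta; split; first exact: mixed_sub_F.
  move: Ta => [b [c [Fb Fc ->]]]; rewrite /colon /= mulrDr mulrCA.
  apply: idealD => //.
    apply: wC; have -> : n + e - e' = e + (n - e') by rewrite addrA [e + _]addrC.
    by apply: F_mul => //; exact: F_yprod.
  apply: F_mixed_sub; have -> : n + e + ui = e + (n + ui) by rewrite addrA [e + _]addrC.
  by apply: F_mul => //; exact: F_yprod.
- by move=> z [].
by apply: (@finlen_sub _ (F (n + ui)) setT); [exact: F_mixed_sub| |exact: F_finlen].
Qed.

End MixedDifference.

End Filtration.

(** * The Hilbert polynomial along lines *)

Section Polynomials.
Variable s : nat.
Implicit Types (n p : vec s).

Lemma peval_line (P : mpoly.mpoly s rat) n p :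
  exists Q : {poly rat}, forall k : nat, Q.[k%:R] = peval P (n + p *+ k).
Proof.
exists (mpoly.mmap polyC (fun i => (n i)%:~R%:P + (p i)%:~R *: 'X) P) => k.
rewrite /peval /mpoly.meval /mpoly.mmap horner_sum; apply: eq_bigr => M _.
rewrite hornerM hornerC /mpoly.mmap1 horner_prod; congr (_ * _).
apply: eq_bigr => i _; rewrite horner_exp !hornerE vaddE vmulnE.
by rewrite intrD -[p i *+ k]mulr_natr intrM natz.
Qed.

Lemma poly_large_eq0 (Q : {poly rat}) K :
  (forall k : nat, (K <= k)%N -> Q.[k%:R] = 0) -> Q = 0.
Proof.
move=> hQ; apply/eqP; apply: contraT => Q0.
have := @max_poly_roots _ Q [seq i%:R | i <- iota K (size Q)] Q0.
rewrite size_map size_iota ltnn; apply.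
  by apply/allP => _ /mapP[i + ->]; rewrite mem_iota => /andP[Ki _]; apply/eqP/hQ.
by rewrite map_inj_uniq ?iota_uniq //; move=> i j /eqP; rewrite eqr_nat => /eqP.
Qed.

Lemma line_large N n : exists K, forall k, (K <= k)%N ->
  forall i, N%:Z <= (n + vone *+ k) i.
Proof.
exists (\sum_i `|n i|%N + N)%N => k hk i; rewrite vaddE vmulnE voneE -mulr_natr.
have : (`|n i|%N <= \sum_j `|n j|%N)%N by rewrite (bigD1 i) //= leq_addr.
by rewrite natz; lia.
Qed.

Lemma affine_of_second_diff (t : nat -> rat) :
  (forall k, t k.+2 + t k = t k.+1 *+ 2) ->
  forall k, t k = t 0%N + (t 1%N - t 0%N) *+ k.
Proof.
move=> ht k; suff : t k = t 0%N + (t 1%N - t 0%N) *+ k /\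
    t k.+1 = t 0%N + (t 1%N - t 0%N) *+ k.+1 by case.
elim: k => [|k [IH1 IH2]]; first by rewrite mulr0n mulr1n; split; ring.
by split=> //; have := ht k; rewrite IH2 IH1 !mulrS; lra.
Qed.

End Polynomials.

(** * Postulation vectors and reduction vectors *)

Section Postulation.
Variables (R : comNzRingType) (m : set R) (s : nat).
Variables (I : 'I_s -> set R) (F : vec s -> set R) (x : 'I_s -> 'I_2 -> R).
Variable P : mpoly.mpoly s rat.
Hypotheses (noethR : noetherian R) (locR : is_local m) (depth2 : depth m 2).
Hypothesis s_ge2 : (2 <= s)%N.
Hypothesis Iprim : forall i, is_mprimary m (I i).
Hypothesis Ffilt : is_filtration I F.
Hypothesis Fpos : forall n, F n = F (vpos n).
Hypothesis xgood : is_good_complete_reduction x I F.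
Hypothesis FP : is_hilbert_poly F P.
Implicit Types (n p q : vec s).

Local Notation e := (@vone s).
Local Notation H := (hilbert_fun F).
Local Notation J := (Jideal x).
Local Notation p_ := (peval P).

(** The equation holds for large n by the two properties of a good complete
    reduction; along the line n + k e both sides are polynomials in k. *)
Lemma peval_second_diff n :
  p_ (n + e) + p_ (n - e) = (colength J)%:R + p_ n *+ 2.
Proof.
have [Q hQ] := peval_line P (n - e) e.
have [N1 h1] := large_reduction xgood.
have [N2 h2] := large_colon noethR locR depth2 s_ge2 Iprim Ffilt xgood.
have [N3 h3] := FP.
have [K hK] := line_large (N1 + N2 + N3 + 1) n.
pose S := Q \Po ('X + 2%:P) + Q - (Q \Po ('X + 1%:P)) *+ 2 - (colength J)%:R%:P.
have SE (k : nat) : S.[k%:R] = p_ (n + e *+ k + e) + p_ (n + e *+ k - e)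
    - p_ (n + e *+ k) *+ 2 - (colength J)%:R.
  rewrite /S !(hornerD, hornerN, hornerMn, horner_comp, hornerX, hornerC).
  rewrite natr1 -(natrD _ k 2) !hQ.
  have -> : n - e + e *+ (k + 2) = n + e *+ k + e.
    by apply/ffunP => j; rewrite !vE mulrnDr; ring.
  have -> : n - e + e *+ k = n + e *+ k - e by rewrite addrAC.
  by have -> : n - e + e *+ k.+1 = n + e *+ k by rewrite mulrS addrA subrK.
suff S0 : S = 0.
  by have := SE 0%N; rewrite S0 horner0 mulr0n addr0; lra.
apply: (@poly_large_eq0 _ K) => k kK; rewrite SE.
have L j := hK k kK j.
rewrite !h3; last 3 first.
- by move=> j; have := L j; lia.
- by move=> j; rewrite vaddE voppE voneE; have := L j; lia.
- by move=> j; rewrite vaddE voneE; have := L j; lia.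
have : ideal_mul J (F (n + e *+ k)) = F (n + e *+ k + e) by apply: h1 => j; have := L j; lia.
rewrite (reduction_diff noethR locR depth2 s_ge2 Iprim Ffilt xgood); last first.
  by apply: h2 => j; have := L j; lia.
by rewrite -!natrD => ->; rewrite natrD -addnn natrD; ring.
Qed.

(** The mixed difference T of P is affine along e; it vanishes at a point with
    i-th coordinate -1, whereas for large vectors it is a positive length that
    does not increase along e. *)
Lemma postulation_ge0 n : postulation_vectors F P n -> vle 0 n.
Proof.
move=> post i; rewrite v0E leNgt; apply/negP => ni.
pose ui := vunit i; pose e' := e - ui.
(* the summand 1 keeps m0 - e' above n *)
pose m0 : vec s := [ffun j => if j == i then -1 else Num.max (n j) 0 + 1].
have m0E j : m0 j = if j == i then -1 else Num.max (n j) 0 + 1 by rewrite ffunE.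
pose T q := p_ (q + ui) - p_ q - p_ (q - e' + ui) + p_ (q - e').
have T2 q : T (q + e) + T (q - e) = T q *+ 2.
  have A1 := peval_second_diff (q + ui); have A2 := peval_second_diff q.
  have A3 := peval_second_diff (q - e' + ui); have A4 := peval_second_diff (q - e').
  rewrite /T (addrAC q e ui) (addrAC q e (- e')) (addrAC (q - e') e ui).
  rewrite (addrAC q (- e) ui) (addrAC q (- e) (- e')) (addrAC (q - e') (- e) ui).
  lra.
pose t k := T (m0 + e *+ k).
have t2 k : t k.+2 + t k = t k.+1 *+ 2.
  rewrite -T2 /t; congr (T _ + T _); apply/ffunP => j; rewrite !vE !mulrS; ring.
have t0 : t 0%N = 0.
  rewrite /t mulr0n addr0 /T.
  have nle q : (forall j, n j <= q j) -> p_ q = (H q)%:R by move=> h; rewrite post.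
  have Hui q : q i = -1 -> H (q + ui) = H q.
    move=> qi; rewrite /hilbert_fun Fpos [F q]Fpos; congr (colength (F _)).
    apply/ffunP => j; rewrite !ffunE; have [->|ji] := eqVneq j i.
      by rewrite qi.
    by rewrite addr0.
  have m0n j : n j + (j != i)%:R <= m0 j.
    by rewrite m0E; case: eqP => [->|_] /=; lia.
  rewrite !nle.
  - rewrite (Hui m0); last by rewrite m0E eqxx.
    rewrite (Hui (m0 - e')); first by ring.
    by rewrite !vE m0E eqxx.
  1-4: by move=> j; rewrite ?vE; have := m0n j; case: (j == i) => /=; lia.
have tE := affine_of_second_diff t2.
have [N1 h1] := FP.
have [N2 h2] := large_mixed_len noethR locR depth2 s_ge2 Iprim Ffilt xgood i.
have [N3 h3] := large_mixed_len_gt0 noethR locR depth2 s_ge2 Iprim Ffilt xgood i.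
have [N4 h4] := large_mixed_len_le noethR locR s_ge2 Iprim Ffilt xgood i.
have [K hK] := line_large (N1 + N2 + N3 + N4 + 1) m0.
have tL k : (K <= k)%N -> t k = (mixed_len F x i (m0 + e *+ k))%:R.
  move=> kK; have L j := hK k kK j; set q := m0 + e *+ k in L *.
  have E : (mixed_len F x i q)%:R + (H q)%:R + (H (q - e' + ui))%:R =
      (H (q + ui))%:R + (H (q - e'))%:R :> rat.
    by rewrite -!natrD h2 // => j; have := L j; lia.
  rewrite /t -/q /T !h1 => [|j|j|j|j]; first by lra.
  1-4: by have := L j; rewrite ?vE; case: (j == i) => /=; lia.
have LK j := hK K (leqnn K) j.
have : 0 < t K.
  by rewrite tL // ltr0n; apply: h3 => j; have := LK j; lia.
have : t K.+1 <= t K.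
  rewrite (tL K.+1) // (tL K) // ler_nat.
  have -> : m0 + e *+ K.+1 = m0 + e *+ K + e by rewrite mulrSr addrA.
  by apply: h4 => j; have := LK j; lia.
rewrite tE [t K]tE t0 !add0r subr0 mulrS.
rewrite gerDr => t1; rewrite ltNge => /negP; apply.
exact: mulrn_wle0.
Qed.

Hypothesis H1 : forall n, vle 0 n ->
  local_cohomology1_zero (Rees (mpow I)) (Rees_pp I) (Rees F) n.

(** The local cohomology in degree n - e controls F(n) : J. *)
Lemma reduction_diff_H1 n : vle e n -> ideal_mul J (F n) = F (n + e) <->
  (H (n + e)%R + H (n - e)%R = colength J + (H n).*2)%N.
Proof.
move=> en; apply: (reduction_diff noethR locR depth2 s_ge2 Iprim Ffilt xgood).
rewrite -{1}(subrK e n).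
have n0 : vle 0 (n - e) by move=> j; rewrite !vE; have := en j; rewrite voneE; lia.
exact: (colon_of_H1_zero noethR locR depth2 s_ge2 Iprim Ffilt xgood n0 (H1 n0)).
Qed.

(** Both conditions concern D = P - H: being a reduction vector says that the
    second differences of D along e vanish, and D vanishes far away. *)
Lemma postulation_reduction n : vle 0 n ->
  postulation_vectors F P n <-> reduction_vectors x F (n + e).
Proof.
move=> n0; split.
  move=> post; split; first by move=> j; rewrite !vE; have := n0 j; rewrite v0E; lia.
  move=> q nq.
  have nqj j : n j + 1 <= q j by have := nq j; rewrite !vE.
  have n0j j : 0 <= n j by have := n0 j; rewrite v0E.
  apply/reduction_diff_H1.
    by move=> j; rewrite voneE; have := nqj j; have := n0j j; lia.
  apply/eqP; rewrite -(eqr_nat rat) !natrD -addnn natrD !post.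
  - by rewrite peval_second_diff.
  - by move=> j; have := nqj j; lia.
  - by move=> j; rewrite !vE; have := nqj j; lia.
  - by move=> j; rewrite !vE; have := nqj j; lia.
move=> [_ red] q nq.
pose D k := p_ (q + e *+ k) - (H (q + e *+ k))%:R.
have D2 k : D k.+2 + D k = D k.+1 *+ 2.
  have := peval_second_diff (q + e *+ k.+1).
  have nqj j : n j + 1 <= (q + e *+ k.+1) j.
    by rewrite !vE; have := nq j; rewrite mulrS -mulr_natr natz; lia.
  have en : vle e (q + e *+ k.+1).
    by move=> j; rewrite voneE; have := nqj j; have := n0 j; rewrite v0E; lia.
  have /(reduction_diff_H1 en)/(congr1 (fun a => a%:R : rat)) :
      ideal_mul J (F (q + e *+ k.+1)) = F (q + e *+ k.+1 + e).
    by apply: red => j; rewrite vaddE voneE; exact: nqj.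
  rewrite -addnn !natrD.
  have -> : q + e *+ k.+1 + e = q + e *+ k.+2 by rewrite [in RHS]mulrSr addrA.
  have -> : q + e *+ k.+1 - e = q + e *+ k by rewrite mulrSr addrA addrK.
  by rewrite /D; lra.
have [N hN] := FP; have [K hK] := line_large N q.
have D0 k : (K <= k)%N -> D k = 0.
  by move=> /hK/hN h; rewrite /D h subrr.
have E1 := affine_of_second_diff D2 K; have E2 := affine_of_second_diff D2 K.+1.
have : D 0%N = 0.
  move: E1 E2; rewrite mulrS (D0 K) // (D0 K.+1) // => E1.
  rewrite addrCA -E1 addr0 => /esym/eqP; rewrite subr_eq0 => /eqP D1.
  by rewrite [RHS]E1 D1 subrr mul0rn addr0.
by rewrite /D mulr0n addr0 => /eqP; rewrite subr_eq0 => /eqP.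
Qed.

End Postulation.

Unset Implicit Arguments.

Theorem theorem1p13 (R : comNzRingType) (m : set R)
    (CMR : cohen_macaulay_local m) (dimR : krull_dim R 2)
    (inf_res : infinite_residue_field m)
    (s : nat) (s_ge2 : (2 <= s)%N)
    (I : 'I_s -> set R) (Iprim : forall i, is_mprimary m (I i))
    (F : vec s -> set R) (Fadm : is_admissible I F)
    (P : mpoly.mpoly s rat) (FP : is_hilbert_poly F P)
    (x : 'I_s -> 'I_2 -> R) (xgood : is_good_complete_reduction x I F)
    (H1 : forall n : vec s, vle 0 n ->
       local_cohomology1_zero (Rees (mpow I)) (Rees_pp I) (Rees F) n) :
  (postulation_vectors F P `<=` [set n | vle 0 n]) /\
  [/\ set_bij (postulation_vectors F P)
        (reduction_vectors x F `&` [set r | vle vone r])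
        (fun n => n + vone),
      set_bij (reduction_vectors x F `&` [set r | vle vone r])
        (postulation_vectors F P)
        (fun r => r - vone),
      forall n, postulation_vectors F P n -> (n + vone) - vone = n
    & forall r, (reduction_vectors x F `&` [set r | vle vone r]) r ->
        (r - vone) + vone = r].
Proof.
have [noethR locR [d [dimd depthd]]] := CMR.
have [Ffilt Fpos _] := Fadm.
have depth2 : depth m 2.
  suff -> : 2%N = d by [].
  by apply/eqP; rewrite eqn_leq; apply/andP; split; [case: dimd|case: dimR] => _; apply;
    [case: dimR|case: dimd].
have ge0 := postulation_ge0 noethR locR depth2 s_ge2 Iprim Ffilt Fpos xgood FP.
have iffP := postulation_reduction noethR locR depth2 s_ge2 Iprim Ffilt xgood FP H1.
have to_red n : postulation_vectors F P n ->
    (reduction_vectors x F `&` [set r | vle vone r]) (n + vone).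
  move=> post; have n0 := ge0 n post; split; first exact/iffP.
  by move=> j; rewrite vaddE voneE; have := n0 j; rewrite v0E; lia.
have to_post r : (reduction_vectors x F `&` [set r | vle vone r]) r ->
    postulation_vectors F P (r - vone).
  move=> [red r1]; apply/iffP; last by rewrite subrK.
  by move=> j; rewrite v0E vaddE voppE voneE; have := r1 j; rewrite voneE; lia.
split; first exact: ge0.
split; [split|split| |] => //.
- by move=> n p _ _ /addIr.
- by move=> r /to_post pr; exists (r - vone) => //; rewrite subrK.
- by move=> r q _ _ /addIr.
- by move=> n /to_red rn; exists (n + vone) => //; rewrite addrK.
- by move=> n _; rewrite addrK.
by move=> r _; rewrite subrK.
Qed.
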